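(* Consider a rate-distortion problem defined by $p_X$ and a finite non-degenerate distortion measure $d$, for which the regularity assumption (see context) on the encoder Jacobian holds. Let $\beta\mapsto\bm{r}_\beta\in\Delta[\hat{\mathcal{X}}]$ be a smooth function on an open interval $I$ containing $\beta_0>0$, such that $BA_\beta[\bm{r}_\beta]=\bm{r}_\beta$ for all $\beta\in I$. Suppose that $\bm{r}_{\beta_0}$ is of full support. Let $\delta>0$ be such that $\delta<\min_{\hat{x}}r_{\beta_0}(\hat{x})$. Then there exists $\beta_f(\delta)$ with $0\le\beta_f(\delta)<\beta_0$ (and $[\beta_f(\delta),\beta_0]\subset I$) such that: 1. for every $\beta\in[\beta_f(\delta),\beta_0]$, $r_\beta(\hat{x})\ge\delta$ for all $\hat{x}\in\hat{\mathcal{X}}$; and 2. for every integer $l>0$, the error of the $l$-th order Taylor method satisfies $$\max_{\beta\in[\beta_f(\delta),\beta_0]}\|\tilde{\bm{r}}_\beta-\bm{r}_\beta\|_\infty=O(|\Delta\beta|^l)$$ for $|\Delta\beta|>0$ small enough, where $\tilde{\bm{r}}_\beta$ are the Taylor method approximations with step size $\Delta\beta<0$ started at $\tilde{\bm{r}}_{\beta_0}=\bm{r}_{\beta_0}$.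
   Context: Setting: finite alphabets $\mathcal{X},\hat{\mathcal{X}}$, $M=|\hat{\mathcal{X}}|$; $p_X$ a distribution on $\mathcal{X}$; $d:\mathcal{X}\times\hat{\mathcal{X}}\to\mathbb{R}_{\ge0}$ is non-degenerate if $d(\cdot,\hat{x}_1)\neq d(\cdot,\hat{x}_2)$ whenever $\hat{x}_1\ne\hat{x}_2$. $\Delta[\hat{\mathcal{X}}]$ is the probability simplex. For $\bm{r}\in\mathbb{R}^M$ (non-negative, nonzero, or near such) put $q(\hat{x}|x)=\frac{r(\hat{x})e^{-\beta d(x,\hat{x})}}{\sum_{\hat{x}'}r(\hat{x}')e^{-\beta d(x,\hat{x}')}}$ and $BA_\beta[\bm{r}](\hat{x})=\sum_xp_X(x)q(\hat{x}|x)$. By abuse of notation, for a conditional distribution $\bm{q}$, $BA_\beta[\bm{q}]$ is the conditional distribution obtained from the marginal $s(\hat{x})=\sum_xp_X(x)q(\hat{x}|x)$ by $\frac{s(\hat{x})e^{-\beta d(x,\hat{x})}}{\sum_{\hat{x}'}s(\hat{x}')e^{-\beta d(x,\hat{x}')}}$. An achieving distribution at $\beta>0$ is a fixed point of $BA_\beta$ (given as a marginal $\bm{r}$ or equivalently as the corresponding encoder $\bm{q}$) minimizing the Lagrangian $I(X;\hat{X})+\beta\,\mathbb{E}[d(X,\hat{X})]$ over all conditional distributions $p(\hat{x}|x)$, with $X\sim p_X$. Regularity assumption: the Jacobian $D_{\bm{q}}(Id-BA_\beta)$ with respect to the encoder coordinates $\bm{q}\in\mathbb{R}^{\hat{\mathcal{X}}\times\mathcal{X}}$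 is non-singular at achieving distributions $\bm{q}_\beta$, except at cluster-vanishing bifurcations, i.e. at points where, along a path of roots as $\beta$ decreases, the marginal probability $r(\hat{x})$ of some symbol $\hat{x}$ gradually vanishes, reaching $r(\hat{x})=0$. Numerical derivatives: let $F(\bm{r},\beta):=\bm{r}-BA_\beta[\bm{r}]$, as a function of the $M+1$ independent real variables $(\bm{r},\beta)$. At points where $D_{\bm{r}}F$ is invertible define $\frac{d^k\bm{r}}{d\beta^k}\big|_{(\bm{r},\beta)}$ recursively (whether or not $(\bm{r},\beta)$ is a root) by $D_{\bm{r}}F[\frac{d\bm{r}}{d\beta}]=-D_\beta F$ and, for $k>1$, $$D_{\bm{r}}F\big[\tfrac{d^k\bm{r}}{d\beta^k}\big]=-\sum\ \sum_{b=0}^{m_1\delta(p_1=1)}\frac{k!}{b!(m_1-b)!m_2!\cdots m_s!(p_1!)^{m_1}\cdots(p_s!)^{m_s}}D^m_{\beta^b,\bm{r}^{m-b}}F\big[(\tfrac{d^{p_1}\bm{r}}{d\beta^{p_1}})_{\times(m_1-b)},(\tfrac{d^{p_2}\bm{r}}{d\beta^{p_2}})_{\times m_2},\dots,(\tfrac{d^{p_s}\bm{r}}{d\beta^{p_s}})_{\times m_s}\big],$$ the outer sum being over partitions $k=m_1p_1+\dots+m_sp_s$ with $0<p_1<\dots<p_s$, $m_i\ge1$, other than the trivial one ($s=1,m_1=1,p_1=k$); $m=m_1+\dots+m_s$; $\delta(p_1=1)$ is $1$ if $p_1=1$ and $0$ otherwise; $(\bm{v})_{\times j}$ means $\bm{v}$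 repeated $j$ times; $D^{b+j}_{\beta^b,\bm{r}^j}F[\bm{v}_1,\dots,\bm{v}_j]$ is the $j$-multilinear form with coefficients $\partial^j_{r_{i_1}\cdots r_{i_j}}\partial_\beta^bF$. On a smooth path of roots these are its true $\beta$-derivatives. Taylor method of order $l$: $T_l(\bm{r},\beta,h):=\sum_{k=1}^l\frac{h^{k-1}}{k!}\frac{d^k\bm{r}}{d\beta^k}\big|_{(\bm{r},\beta)}$. With $\beta_n=\beta_0+n\Delta\beta$, set $\tilde{\bm{r}}_0=\bm{r}_{\beta_0}$ and $\tilde{\bm{r}}_{n+1}=\tilde{\bm{r}}_n+\Delta\beta\cdot T_l(\tilde{\bm{r}}_n,\beta_n,\Delta\beta)$; $\tilde{\bm{r}}_{\beta_n}:=\tilde{\bm{r}}_n$, and for off-grid $\beta\in(\beta_{n+1},\beta_n)$ extrapolate from the last grid point: $\tilde{\bm{r}}_\beta:=\tilde{\bm{r}}_n+(\beta-\beta_n)T_l(\tilde{\bm{r}}_n,\beta_n,\beta-\beta_n)$. *)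

(* Defs.v *)
From HB Require Import structures.
From mathcomp Require Import all_boot all_order all_algebra.
From mathcomp Require Import all_classical all_reals all_analysis.

Set Implicit Arguments.
Unset Strict Implicit.
Unset Printing Implicit Defensive.
Import Order.TTheory GRing.Theory Num.Theory.
Import numFieldNormedType.Exports.

Local Open Scope classical_set_scope.
Local Open Scope ring_scope.

(* The source alphabet is 'I_N and the
   reproduction alphabet is 'I_M. A source distribution is a row vector
   p : 'rV_N, a marginal is r : 'rV_M, and an encoder (conditional distribution)
   is q : 'M_(N, M) with q x xh = q(xh | x). *)

Section RateDistortion.
Context {R : realType} {N M : nat}.

Definition simplex (n : nat) : set 'rV[R]_n :=
  [set r | (forall i, 0 <= r 0 i) /\ \sum_i r 0 i = 1].

Definition cond_dist : set 'M[R]_(N, M) :=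
  [set q | forall x, row x q \in @simplex M].

Definition nonneg_distortion (d : 'M[R]_(N, M)) : Prop :=
  forall x xh, 0 <= d x xh.

Definition non_degenerate (d : 'M[R]_(N, M)) : Prop :=
  forall xh1 xh2, xh1 != xh2 -> col xh1 d != col xh2 d.

Definition partition_fun (d : 'M[R]_(N, M)) (beta : R) (r : 'rV[R]_M)
    (x : 'I_N) : R :=
  \sum_xh r 0 xh * expR (- (beta * d x xh)).

Definition encoder (d : 'M[R]_(N, M)) (beta : R) (r : 'rV[R]_M) :
    'M[R]_(N, M) :=
  \matrix_(x, xh)
    (r 0 xh * expR (- (beta * d x xh)) / partition_fun d beta r x).

Definition marginal (p : 'rV[R]_N) (q : 'M[R]_(N, M)) : 'rV[R]_M :=
  \row_xh \sum_x p 0 x * q x xh.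

Definition BA (p : 'rV[R]_N) (d : 'M[R]_(N, M)) (beta : R) (r : 'rV[R]_M) :
    'rV[R]_M :=
  marginal p (encoder d beta r).

Definition BA_enc (p : 'rV[R]_N) (d : 'M[R]_(N, M)) (beta : R)
    (q : 'M[R]_(N, M)) : 'M[R]_(N, M) :=
  encoder d beta (marginal p q).

(* In nats. The convention 0 ln 0 = 0 holds because the prefactor vanishes;
   marginal p q 0 xh = 0 forces p 0 x * q x xh = 0 for distributions. *)
Definition mutual_info (p : 'rV[R]_N) (q : 'M[R]_(N, M)) : R :=
  \sum_x \sum_xh p 0 x * q x xh * ln (q x xh / marginal p q 0 xh).

Definition expected_distortion (p : 'rV[R]_N) (d q : 'M[R]_(N, M)) : R :=
  \sum_x \sum_xh p 0 x * q x xh * d x xh.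

Definition lagrangian (p : 'rV[R]_N) (d : 'M[R]_(N, M)) (beta : R)
    (q : 'M[R]_(N, M)) : R :=
  mutual_info p q + beta * expected_distortion p d q.

Definition achieving (p : 'rV[R]_N) (d : 'M[R]_(N, M)) (beta : R)
    (q : 'M[R]_(N, M)) : Prop :=
  [/\ q \in cond_dist,
      BA_enc p d beta q = q &
      forall q', q' \in cond_dist ->
        lagrangian p d beta q <= lagrangian p d beta q'].

(* Nothing beyond continuity is required of the path of roots, as it need not
   be smooth at the bifurcation. *)
Definition cluster_vanishing (p : 'rV[R]_N) (d : 'M[R]_(N, M)) (beta_c : R)
    (q : 'M[R]_(N, M)) : Prop :=
  exists (eps : R) (rho : R -> 'rV[R]_M) (xh : 'I_M),
    [/\ 0 < eps,
        {within `[beta_c, beta_c + eps[, continuous rho},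
        forall beta, beta_c <= beta < beta_c + eps ->
          rho beta \in @simplex M /\ BA p d beta (rho beta) = rho beta,
        rho beta_c = marginal p q &
        (forall beta, beta_c < beta < beta_c + eps -> 0 < rho beta 0 xh) /\
        rho beta_c 0 xh = 0].

(* lin_mx turns the differential on 'M_(N, M) into a square matrix of size
   N * M, the Jacobian in the coordinates q(xh | x). These are independent
   coordinates: q is not constrained to be normalized. *)
Definition encoder_jacobian (p : 'rV[R]_N) (d : 'M[R]_(N, M)) (beta : R)
    (q : 'M[R]_(N, M)) : 'M[R]_(N * M) :=
  lin_mx ('d (fun q' : 'M[R]_(N, M) => q' - BA_enc p d beta q') q).

Definition regularity_assumption (p : 'rV[R]_N) (d : 'M[R]_(N, M)) : Prop :=
  forall (beta : R) (q : 'M[R]_(N, M)),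
    0 < beta -> achieving p d beta q -> ~ cluster_vanishing p d beta q ->
    encoder_jacobian p d beta q \in unitmx.

Definition smooth_on (I : set R) (f : R -> 'rV[R]_M) : Prop :=
  forall (n : nat) (x : R), I x -> derivable (f^`(n))%classic x 1.

Definition partial_r (i : 'I_M) (G : 'rV[R]_M -> R -> 'rV[R]_M) :
    'rV[R]_M -> R -> 'rV[R]_M :=
  fun r beta => 'D_(delta_mx 0 i) (fun r' : 'rV[R]_M => G r' beta) r.

Definition partial_beta (G : 'rV[R]_M -> R -> 'rV[R]_M) :
    'rV[R]_M -> R -> 'rV[R]_M :=
  fun r beta => ((G r)^`())%classic beta.

Definition mixed_partial (G : 'rV[R]_M -> R -> 'rV[R]_M) (b : nat)
    (s : seq 'I_M) : 'rV[R]_M -> R -> 'rV[R]_M :=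
  foldr partial_r (iter b partial_beta G) s.

(* D^(b + j)_(beta^b, r^j) G [v_1, ..., v_j] with vs = [:: v_1; ...; v_j] *)
Definition Dform (G : 'rV[R]_M -> R -> 'rV[R]_M) (r : 'rV[R]_M) (beta : R)
    (b : nat) (vs : seq 'rV[R]_M) : 'rV[R]_M :=
  \sum_(s : (size vs).-tuple 'I_M)
    (\prod_(t < size vs) vs`_t 0 (tnth s t)) *: mixed_partial G b s r beta.

(* Row-vector convention: v *m jacobian_r G r beta = D_r G [v]. *)
Definition jacobian_r (G : 'rV[R]_M -> R -> 'rV[R]_M) (r : 'rV[R]_M)
    (beta : R) : 'M[R]_M :=
  \matrix_(i, j) partial_r i G r beta 0 j.

Definition FBA (p : 'rV[R]_N) (d : 'M[R]_(N, M)) (r : 'rV[R]_M) (beta : R) :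
    'rV[R]_M :=
  r - BA p d beta r.

(* A partition k = m_1 p_1 + ... + m_s p_s is encoded by its multiplicities:
   c p = m_i if p = p_i, and c p = 0 if p is not a part. The part k occurs in
   the trivial partition only. *)
Definition nontrivial_partition (k : nat) (c : {ffun 'I_k.+1 -> 'I_k.+1}) :
    bool :=
  [&& c ord0 == 0 :> nat,
      \sum_(i < k.+1) c i * i == k &
      c ord_max == 0 :> nat]%N.

Definition mult1 (k : nat) (c : {ffun 'I_k.+1 -> 'I_k.+1}) : nat :=
  (\sum_(i < k.+1 | i == 1 :> nat) c i)%N.

(* Number of times the p-th derivative is an argument of D^m_(beta^b, r^(m-b)):
   b of the parts equal to 1 are used up by the beta-derivatives. *)
Definition nb_args (k : nat) (c : {ffun 'I_k.+1 -> 'I_k.+1}) (b : nat)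
    (i : 'I_k.+1) : nat :=
  (c i - (if i == 1 :> nat then b else 0))%N.

Definition partition_coef (k : nat) (c : {ffun 'I_k.+1 -> 'I_k.+1}) (b : nat) :
    R :=
  k`!%:R / (b`! * \prod_(i < k.+1) ((nb_args c b i)`! * i`! ^ c i))%N%:R.

(* vs = [:: v_1; ...; v_(k-1)] lists the derivatives of order 1, ..., k - 1,
   whence the shift i.-1; i = 0 has multiplicity 0. *)
Definition partition_args (k : nat) (c : {ffun 'I_k.+1 -> 'I_k.+1}) (b : nat)
    (vs : seq 'rV[R]_M) : seq 'rV[R]_M :=
  flatten [seq nseq (nb_args c b i) vs`_(i.-1) | i <- enum 'I_k.+1].

Definition deriv_rhs (G : 'rV[R]_M -> R -> 'rV[R]_M) (r : 'rV[R]_M) (beta : R)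
    (k : nat) (vs : seq 'rV[R]_M) : 'rV[R]_M :=
  if k == 1%N then - partial_beta G r beta else
  - \sum_(c : {ffun 'I_k.+1 -> 'I_k.+1} | nontrivial_partition c)
      \sum_(b < (mult1 c).+1)
        partition_coef c b *: Dform G r beta b (partition_args c b vs).

(* The numerical derivatives of orders 1, ..., k. They are meaningful only where
   jacobian_r G r beta is invertible (invmx is the identity function on
   singular matrices). *)
Fixpoint num_derivs (G : 'rV[R]_M -> R -> 'rV[R]_M) (r : 'rV[R]_M) (beta : R)
    (k : nat) : seq 'rV[R]_M :=
  if k is k'.+1 then
    let vs := num_derivs G r beta k' in
    rcons vs (deriv_rhs G r beta k vs *m invmx (jacobian_r G r beta))
  else [::].

Definition num_deriv (G : 'rV[R]_M -> R -> 'rV[R]_M) (r : 'rV[R]_M) (beta : R)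
    (k : nat) : 'rV[R]_M :=
  (num_derivs G r beta k)`_(k.-1).

Definition num_deriv_defined (p : 'rV[R]_N) (d : 'M[R]_(N, M)) (r : 'rV[R]_M)
    (beta : R) : Prop :=
  (forall x, partition_fun d beta r x != 0) /\
  jacobian_r (FBA p d) r beta \in unitmx.

Definition taylor_incr (p : 'rV[R]_N) (d : 'M[R]_(N, M)) (l : nat)
    (r : 'rV[R]_M) (beta h : R) : 'rV[R]_M :=
  \sum_(1 <= k < l.+1) (h ^+ k.-1 / k`!%:R) *: num_deriv (FBA p d) r beta k.

Definition grid (beta0 h : R) (n : nat) : R := beta0 + n%:R * h.

Fixpoint taylor_grid (p : 'rV[R]_N) (d : 'M[R]_(N, M)) (l : nat)
    (r0 : 'rV[R]_M) (beta0 h : R) (n : nat) : 'rV[R]_M :=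
  if n is n'.+1 then
    let r := taylor_grid p d l r0 beta0 h n' in
    r + h *: taylor_incr p d l r (grid beta0 h n') h
  else r0.

(* For h < 0 and beta <= beta0, n is the index of the last grid point >= beta,
   so that grid n.+1 < beta <= grid n. At beta = grid n the added term is 0. *)
Definition taylor_approx (p : 'rV[R]_N) (d : 'M[R]_(N, M)) (l : nat)
    (r0 : 'rV[R]_M) (beta0 h beta : R) : 'rV[R]_M :=
  let n := Num.truncn ((beta - beta0) / h) in
  let r := taylor_grid p d l r0 beta0 h n in
  let t := beta - grid beta0 h n in
  r + t *: taylor_incr p d l r (grid beta0 h n) t.

(* The numerical derivatives entering taylor_approx at beta are those at the
   grid points strictly above beta. *)
Definition taylor_defined (p : 'rV[R]_N) (d : 'M[R]_(N, M)) (l : nat)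
    (r0 : 'rV[R]_M) (beta0 h beta : R) : Prop :=
  forall n, beta < grid beta0 h n ->
    num_deriv_defined p d (taylor_grid p d l r0 beta0 h n) (grid beta0 h n).

End RateDistortion.

(* Main.v *)
(* A fixed point of full support satisfies the optimality conditions of the
   Lagrangian, so its encoder is achieving, and no cluster vanishes there: the
   regularity assumption applies. With B the map from encoders to marginals and
   A the one from marginals to encoders, the encoder Jacobian is Id - DA DB and
   the marginal one is Id - DB DA, and the former is nonsingular only if the
   latter is. On a small box around (r_beta0, beta0) the marginal Jacobian then
   stays away from singularity, so that all numerical derivatives are defined
   and Lipschitz in r there. On the path of roots they agree with the true
   derivatives, by a multivariate Faa di Bruno formula, so one Taylor step has
   local error O(h^(l+1)), and the usual discrete Gronwall argument gives a
   global error O(h^l). The box, hence beta_f, does not depend on l. *)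

Require Import Defs.
From HB Require Import structures.
From mathcomp Require Import all_boot all_order all_algebra.
From mathcomp Require Import all_classical all_reals all_analysis.
From mathcomp Require Import ring lra zify.

Set Implicit Arguments.
Unset Strict Implicit.
Unset Printing Implicit Defensive.
Import Order.TTheory GRing.Theory Num.Theory.
Import numFieldNormedType.Exports.

Local Open Scope classical_set_scope.
Local Open Scope ring_scope.

(** The delicate point is to match the combinatorial definition of the numerical derivatives with
    the k-th derivative of the identity F(r_beta, beta) = 0. With beta as one more slot of weight 1,
    that derivative divided by k! is a sum over multiplicities n of weight k, whose coefficients are
    the inverses of the products of n_x! (x!)^(n_x). In this form it obeys a recurrence in k, so it
    vanishes for every k on a path of roots. Reindexing turns it into the sum over partitions; the
    excluded trivial partition is D_r F applied to the k-th derivative, and the recursion is the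
    equation solved for that term.

    Lipschitz continuity is needed in r only, at a common beta, since the numerical and the exact
    point are always compared at the same beta. The partition functions are the only denominators of
    F; they are positive on the open set of vectors of full support. *)

Lemma sum_bij (V : nmodType) (I J : finType) (P : pred I) (Q : pred J)
    (h : J -> I) (h' : I -> J) (F : I -> V) (G : J -> V) :
  (forall j, Q j -> P (h j) /\ h' (h j) = j) ->
  (forall i, P i -> Q (h' i) /\ h (h' i) = i) ->
  (forall j, Q j -> F (h j) = G j) ->
  \sum_(i | P i) F i = \sum_(j | Q j) G j.
Proof.
move=> hQ hP hFG.
rewrite (reindex_onto h h') => [|i /hP[]//].
apply: eq_big => [j|j /andP[Pj /eqP h'j]].
  apply/andP/idP => [[Pj /eqP <-]|Qj]; first by case: (hP _ Pj).
  by have [-> ->] := hQ _ Qj.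
by apply: hFG; rewrite -h'j; case: (hP _ Pj).
Qed.

(** * Combinatorics of the Faa di Bruno formula *)

(* [n ord0] is the number of derivatives in beta and, for i > 0, [n i] is the
   number of arguments equal to the i-th derivative of the path; the former have
   weight 1. Differentiating a term along the path increments some [n j] and,
   if j > 1, decrements [n j.-1]: this is [shift_up j]. *)
Section Multiplicities.
Local Open Scope nat_scope.
Variable K : nat.
Implicit Types (n : {ffun 'I_K.+1 -> 'I_K.+1}) (j x : 'I_K.+1).

Definition part_weight (j : nat) := maxn j 1.
Definition weight n := \sum_(j < K.+1) part_weight j * n j.
Definition decr (j x : nat) : bool := (1 < j) && (x.+1 == j).
Definition shift_up j n : {ffun 'I_K.+1 -> 'I_K.+1} :=
  [ffun x => inord (n x + (x == j) - decr j x)].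
Definition shift_down j n : {ffun 'I_K.+1 -> 'I_K.+1} :=
  [ffun x => inord (n x + decr j x - (x == j))].
(** The number of summands of the product rule that yield [shift_up j n]: one for the explicit beta
    ([j = 0]), one for the dependence through r ([j = 1]), otherwise one for each argument equal to
    the derivative of order [j.-1]. *)
Definition nb_shift (j : nat) n :=
  if j <= 1 then 1 else n (inord j.-1) : nat.
(** Denominator of the Faa di Bruno coefficient. As 0! = 1, slot 0 contributes just the factorial of
    the number of beta-derivatives. *)
Definition fact_prod n := \prod_(x < K.+1) ((n x)`! * x`! ^ n x).
Definition args_of n : seq nat :=
  flatten [seq nseq ((i != 0 :> nat) * n i) (i : nat) | i : 'I_K.+1 <- enum 'I_K.+1].

Lemma part_weight_gt0 j : 0 < part_weight j. Proof. by rewrite leq_max orbT. Qed.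

Lemma leq_weight n x : part_weight x * n x <= weight n.
Proof. by rewrite /weight (bigD1 x) //= leq_addr. Qed.

Lemma leq_weight2 n x (y : 'I_K.+1) : x != y ->
  part_weight x * n x + part_weight y * n y <= weight n.
Proof.
move=> xy; rewrite /weight (bigD1 x) //= leq_add2l (bigD1 y) ?leq_addr//.
by rewrite eq_sym.
Qed.

Lemma sum_pick (F : 'I_K.+1 -> nat) j : \sum_(x < K.+1) F x * (x == j) = F j.
Proof.
by rewrite (bigD1 j)//= eqxx muln1 big1 ?addn0// => x /negPf->; rewrite muln0.
Qed.

Lemma decr_inord j x : decr j x = (1 < j) && (x == inord j.-1).
Proof.
rewrite /decr; case: ltnP => //= j1.
by have := ltn_ord j; rewrite -val_eqE /= => ?; rewrite inordK; lia.
Qed.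

Lemma sum_decr (F : 'I_K.+1 -> nat) j :
  \sum_(x < K.+1) F x * decr j x = if j <= 1 then 0 else F (inord j.-1).
Proof.
under eq_bigr => x _ do rewrite decr_inord ltnNge.
by case: leqP => j1 /=; [rewrite big1// => x _; rewrite muln0|exact: sum_pick].
Qed.

Lemma decr_neq j x : decr j x -> x != j.
Proof. by rewrite -val_eqE /= /decr; lia. Qed.

Lemma nb_shift_decr j n x : 0 < nb_shift j n -> decr j x -> 0 < n x.
Proof.
rewrite decr_inord /nb_shift => + /andP[j1 /eqP->].
by rewrite [(j <= 1)]leqNgt j1.
Qed.

Lemma decr_nb_shift j n :
  (forall x, decr j x -> 0 < n x) -> 0 < nb_shift j n.
Proof.
rewrite /nb_shift => H; case: (leqP j 1) => // j1; apply: H.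
by rewrite decr_inord j1 eqxx.
Qed.

(** Additive, so that sums over slots can be compared without truncated subtraction. The bound
    [k < K] leaves room for the increment in ['I_K.+1], and [0 < nb_shift j n] for the decrement. *)
Lemma shift_upE k j n x : k < K -> weight n = k -> 0 < nb_shift j n ->
  shift_up j n x + decr j x = n x + (x == j) :> nat.
Proof.
move=> kK nk nj; rewrite ffunE inordK.
  have := @nb_shift_decr j n x nj.
  by case: decr => [/(_ isT)|_] /=; case: (x == j) => /=; lia.
have := leq_weight n x; have := part_weight_gt0 x; rewrite nk => ? ?.
have : n x <= k by nia.
by case: (x == j); case: (decr j x) => /=; lia.
Qed.

Lemma shift_downE k j n x : k < K -> weight n = k.+1 -> 0 < n j ->
  shift_down j n x + (x == j) = n x + decr j x :> nat.
Proof.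
move=> kK nk nj; rewrite ffunE inordK; first by case: eqP => [->|_] /=; lia.
have [xj|xj] := eqVneq x j; first by have := ltn_ord (n x); case: decr => /=; lia.
have := leq_weight2 n xj.
have := part_weight_gt0 x; have := part_weight_gt0 j; rewrite nk => ? ? ?.
have : n x < k.+1 by nia.
by case: decr => /=; lia.
Qed.

(** The weight grows by exactly 1: slots 0 and 1 weigh 1, and for [j > 1] a part [j.-1] becomes a
    part [j]. Together with [shift_downP] this gives a bijection. *)
Lemma shift_upP k j n : k < K -> weight n = k -> 0 < nb_shift j n ->
  [/\ weight (shift_up j n) = k.+1, 0 < shift_up j n j &
      shift_down j (shift_up j n) = n].
Proof.
move=> kK nk nj.
have E x := shift_upE x kK nk nj.
have up_k : weight (shift_up j n) = k.+1.
  have : weight (shift_up j n) + \sum_(x < K.+1) part_weight x * decr j x =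
         weight n + \sum_(x < K.+1) part_weight x * (x == j).
    rewrite -!big_split /=; apply: eq_bigr => x _.
    by rewrite -!mulnDr E.
  rewrite nk sum_decr sum_pick /part_weight.
  case: leqP => j1; first by case: (j : nat) j1 => [|[]]//; lia.
  by have := ltn_ord j; move=> ?; rewrite inordK; lia.
have up_j : 0 < shift_up j n j.
  have := E j; rewrite eqxx; suff -> : decr j j = false by lia.
  by rewrite /decr; lia.
split=> //; apply/ffunP => x; apply/val_inj => /=.
have := shift_downE x kK up_k up_j; have := E x; lia.
Qed.

Lemma shift_downP k j n : k < K -> weight n = k.+1 -> 0 < n j ->
  [/\ weight (shift_down j n) = k, 0 < nb_shift j (shift_down j n) &
      shift_up j (shift_down j n) = n].
Proof.
move=> kK nk nj.
have E x := shift_downE x kK nk nj.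
have dn_k : weight (shift_down j n) = k.
  have : weight (shift_down j n) + \sum_(x < K.+1) part_weight x * (x == j) =
         weight n + \sum_(x < K.+1) part_weight x * decr j x.
    rewrite -!big_split /=; apply: eq_bigr => x _.
    by rewrite -!mulnDr E.
  rewrite nk sum_decr sum_pick /part_weight.
  case: leqP => j1; first by case: (j : nat) j1 => [|[]]//; lia.
  by have := ltn_ord j; move=> ?; rewrite inordK; lia.
have dn_j : 0 < nb_shift j (shift_down j n).
  apply: decr_nb_shift => x dx; have := E x; rewrite dx (negPf (decr_neq dx)).
  lia.
split=> //; apply/ffunP => x; apply/val_inj => /=.
have := shift_upE x kK dn_k dn_j; have := E x; lia.
Qed.

Lemma prod_pick (c : nat) j : \prod_(x < K.+1) (if x == j then c else 1) = c.
Proof.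
by rewrite (bigD1 j)//= eqxx big1 ?muln1// => x /negPf->.
Qed.

(** Slot [j] gains its new multiplicity times j!, and for [j > 1] slot [j.-1] loses its old
    multiplicity times (j-1)!; the quotient of these two factorials is the weight [j]. *)
Lemma fact_prod_shift k j n : k < K -> weight n = k -> 0 < nb_shift j n ->
  fact_prod (shift_up j n) * nb_shift j n =
  part_weight j * shift_up j n j * fact_prod n.
Proof.
move=> kK nk nj.
have E x := shift_upE x kK nk nj.
have : fact_prod (shift_up j n) *
    \prod_(x < K.+1) (if decr j x then n x * x`! else 1) =
    fact_prod n * \prod_(x < K.+1) (if x == j then shift_up j n j * j`! else 1).
  rewrite -!big_split /=; apply: eq_bigr => x _; move: (E x).
  have [xj|xj] := eqVneq x j.
    subst x; have -> : decr j j = false by rewrite /decr; lia.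
    rewrite addn0 addn1 => ->.
    by rewrite factS expnS; lia.
  have := @nb_shift_decr j n x nj.
  case: decr => [/(_ isT)|_] /=; last by rewrite !addn0 => ->.
  case: (nat_of_ord (n x)) => // m _; rewrite addn1 addn0 => -[->].
  by rewrite factS expnS; lia.
rewrite prod_pick /nb_shift.
case: leqP => j1.
  rewrite big1; last by move=> x _; rewrite /decr ltnNge j1.
  have -> : part_weight j = 1 by rewrite /part_weight; lia.
  have -> : j`! = 1 by case: (j : nat) j1 => [|[]].
  by rewrite !muln1 mul1n mulnC.
under eq_bigr => x _ do rewrite decr_inord j1 /=.
have -> : \prod_(x < K.+1) (if x == inord j.-1 then n x * x`! else 1) =
  n (inord j.-1) * (j.-1)`!.
  rewrite -[RHS](prod_pick _ (inord j.-1)); apply: eq_bigr => x _.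
  by case: eqP => // ->; rewrite inordK//; have := ltn_ord j; lia.
have -> : j`! = part_weight j * (j.-1)`!.
  by case: (nat_of_ord j) j1 => // m _; rewrite factS /part_weight /=; lia.
move=> H; apply/eqP; rewrite -(eqn_pmul2r (fact_gt0 j.-1)); apply/eqP; lia.
Qed.

Lemma count_args_of n (y : nat) :
  count_mem y (args_of n) = \sum_(x < K.+1) (x == y :> nat) * ((y != 0) * n x).
Proof.
rewrite /args_of count_flatten sumnE big_map big_map /= big_enum /=.
apply: eq_bigr => x _; rewrite count_nseq /=.
by case: eqP => [->|]; rewrite ?mul1n ?mul0n.
Qed.

Lemma mem_args_of n j : j != 0 :> nat -> 0 < n j -> (j : nat) \in args_of n.
Proof.
move=> j0 nj; rewrite -has_pred1 has_count count_args_of.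
by rewrite (bigD1 j)//= eqxx j0 !mul1n ltn_addr.
Qed.

Lemma shift_up_ord0 k j n : k < K -> weight n = k -> 0 < nb_shift j n ->
  shift_up j n ord0 = n ord0 + (j == 0 :> nat) :> nat.
Proof.
move=> kK nk nj; have := shift_upE ord0 kK nk nj.
rewrite -val_eqE /= eq_sym.
have -> : decr j 0 = false by rewrite /decr; lia.
by rewrite addn0.
Qed.

(** Three cases in one: [j = 0] leaves the arguments alone, [j = 1] adds one, and [j > 1] replaces
    [j.-1] by [j]. *)
Lemma perm_args_shift k j n : k < K -> weight n = k -> 0 < nb_shift j n ->
  perm_eq (nseq (1 < j) j.-1 ++ args_of (shift_up j n))
          (nseq (0 < j) (j : nat) ++ args_of n).
Proof.
move=> kK nk nj; apply/allP => y _ /=; apply/eqP.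
rewrite !count_cat !count_nseq !count_args_of /=.
have : \sum_(x < K.+1) (x == y :> nat) * ((y != 0) * shift_up j n x) +
       \sum_(x < K.+1) (x == y :> nat) * (y != 0) * decr j x =
       \sum_(x < K.+1) (x == y :> nat) * ((y != 0) * n x) +
       \sum_(x < K.+1) (x == y :> nat) * (y != 0) * (x == j).
  rewrite -!big_split /=; apply: eq_bigr => x _.
  rewrite -!mulnA -!mulnDr; congr (_ * (_ * _)).
  by have := shift_upE x kK nk nj.
rewrite (sum_pick (fun x => (x == y :> nat) * (y != 0)) j).
rewrite (sum_decr (fun x => (x == y :> nat) * (y != 0)) j).
case: leqP => j1.
  by case: (nat_of_ord j) j1 => [|[|]]//= _; case: y => [|[|y]] //=; lia.
rewrite inordK; last by have := ltn_ord j; lia.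
move=> H; rewrite addnC.
have -> : 0 < j by lia.
move: H; move: (bigop _ _ _) (bigop _ _ _) => S1 S2.
case: (nat_of_ord j) j1 => [|[|jj]] //= _.
case: y => [|y] /=; rewrite ?muln1 ?muln0 ?eqSS; lia.
Qed.

Lemma perm_args_shift2 k j n : k < K -> weight n = k -> 1 < j ->
  0 < n (inord j.-1) ->
  perm_eq (args_of (shift_up j n)) ((j : nat) :: rem j.-1 (args_of n)).
Proof.
move=> kK nk j1 nj.
have nj' : 0 < nb_shift j n by rewrite /nb_shift [(j <= 1)]leqNgt j1.
have P := perm_args_shift kK nk nj'; rewrite j1 (ltnW j1) /= in P.
rewrite -(perm_cons j.-1); apply: perm_trans P _.
rewrite -(cat1s j.-1) perm_sym (perm_catCA [:: j.-1] [:: _]) /= perm_cons.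
rewrite perm_sym; apply: perm_to_rem.
have -> : j.-1 = (inord j.-1 : 'I_K.+1) :> nat.
  by rewrite inordK //; have := ltn_ord j; lia.
by apply: mem_args_of => //; have := ltn_ord j => ?; rewrite inordK; lia.
Qed.

End Multiplicities.

(** * Recurrence for the Faa di Bruno sums *)

Section BellRecurrence.
Variables (F : numFieldType) (K : nat) (A : nat -> seq nat -> F).
Hypothesis A_perm : forall b s s', perm_eq s s' -> A b s = A b s'.
Implicit Types (n : {ffun 'I_K.+1 -> 'I_K.+1}) (j : 'I_K.+1).

Definition bell_term n : F := A (n ord0) (args_of n).
(** If [A b s] is the form D_(beta^b, r^m) F on the derivatives of the orders listed in [s], this is
    the k-th derivative of F along the path, divided by k!. The bound [K] is fixed so that all [k]
    share one index type. *)
Definition bell_sum k : F :=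
  \sum_(n : {ffun 'I_K.+1 -> 'I_K.+1} | weight n == k)
    (fact_prod n)%:R^-1 * bell_term n.

Lemma fact_prod_neq0 n : (fact_prod n)%:R != 0 :> F.
Proof.
rewrite pnatr_eq0 -lt0n prodn_gt0// => x.
by rewrite muln_gt0 fact_gt0 expn_gt0 fact_gt0.
Qed.

(** Reindexing along [shift_up j]: the terms outside its domain or image have coefficient 0, and
    [fact_prod_shift] matches the others. *)
Lemma bell_shift k j : (k < K)%N ->
  \sum_(n : {ffun 'I_K.+1 -> 'I_K.+1} | weight n == k)
     (fact_prod n)%:R^-1 * ((nb_shift j n)%:R * bell_term (shift_up j n)) =
  \sum_(n : {ffun 'I_K.+1 -> 'I_K.+1} | weight n == k.+1)
     (fact_prod n)%:R^-1 * ((part_weight j * n j)%:R * bell_term n).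
Proof.
move=> kK.
rewrite (bigID (fun n => (0 < nb_shift j n)%N)) /=.
rewrite [X in _ + X]big1 ?addr0; last first.
  by move=> n /andP[_]; rewrite lt0n negbK => /eqP->; rewrite mul0r mulr0.
rewrite [RHS](bigID (fun n => (0 < n j)%N)) /=.
rewrite [X in _ = _ + X]big1 ?addr0; last first.
  by move=> n /andP[_]; rewrite lt0n negbK => /eqP->; rewrite muln0 mul0r mulr0.
symmetry; apply: (sum_bij (h := shift_up j) (h' := shift_down j)).
- move=> n /andP[/eqP nk nj].
  by have [-> -> ->] := shift_upP kK nk nj; rewrite eqxx.
- move=> n /andP[/eqP nk nj].
  by have [-> -> ->] := shift_downP kK nk nj; rewrite eqxx.
move=> n /andP[/eqP nk nj]; rewrite !mulrA; congr (_ * _).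
have := fact_prod_shift kK nk nj => /(congr1 (fun m => m%:R : F)).
rewrite !natrM => E.
have n0 := fact_prod_neq0 n; have u0 := fact_prod_neq0 (shift_up j n).
have -> : (nb_shift j n)%:R = (fact_prod (shift_up j n))%:R^-1 *
    ((part_weight j)%:R * (shift_up j n j)%:R * (fact_prod n)%:R) :> F.
  by rewrite -E mulKf.
by field; rewrite n0 u0.
Qed.

(* The left-hand side is the derivative of [bell_sum k] along the path, see
   [is_derive_dirderiv]; [k.+1] on the right arises as the weight of [n]. *)
Lemma bell_sumS k : (k < K)%N ->
  \sum_(n : {ffun 'I_K.+1 -> 'I_K.+1} | weight n == k) (fact_prod n)%:R^-1 *
     (A (n ord0).+1 (args_of n) + A (n ord0) (1%N :: args_of n) +
      \sum_(q <- args_of n) A (n ord0) (q.+1 :: rem q (args_of n))) =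
  k.+1%:R * bell_sum k.+1.
Proof.
move=> kK; rewrite /bell_sum mulr_sumr.
transitivity (\sum_(n : {ffun 'I_K.+1 -> 'I_K.+1} | weight n == k.+1)
   \sum_(j < K.+1)
     (fact_prod n)%:R^-1 * ((part_weight j * n j)%:R * bell_term n)); last first.
  apply: eq_bigr => n /eqP nk.
  by rewrite -mulr_sumr -mulr_suml -natr_sum -/(weight n) nk mulrCA.
rewrite exchange_big /=.
under [RHS]eq_bigr => j _ do rewrite -(bell_shift j kK).
rewrite exchange_big /=; apply: eq_bigr => n /eqP nk.
rewrite -mulr_sumr; congr (_ * _).
rewrite /args_of big_flatten big_map big_enum /= -/(args_of n).
under eq_bigr => i _ do rewrite big_nseq iter_addr addr0.
have {}nK i : (n i <= k)%N.
  by have := leq_weight n i; have := part_weight_gt0 i; rewrite nk; nia.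
have nKK : n ord_max = 0%N :> nat.
  have := leq_weight n ord_max; rewrite nk /part_weight /=; nia.
pose g (j : 'I_K.+1) : F := (nb_shift j n)%:R * bell_term (shift_up j n).
have g_small j : (j <= 1)%N ->
    g j = A (n ord0 + (j == 0 :> nat))%N (nseq (0 < j)%N (j : nat) ++ args_of n).
  move=> j1; have nj : (0 < nb_shift j n)%N by rewrite /nb_shift j1.
  rewrite /g /nb_shift j1 mul1r /bell_term (shift_up_ord0 kK nk nj).
  apply: A_perm; have := perm_args_shift kK nk nj.
  by rewrite ltnNge j1.
have g_big j : (1 < j)%N ->
    g j = (n (inord j.-1))%:R * A (n ord0) ((j : nat) :: rem j.-1 (args_of n)).
  move=> j1; rewrite /g /nb_shift [(j <= 1)%N]leqNgt j1 /=.
  have [->|] := posnP (n (inord j.-1)); first by rewrite !mul0r.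
  move=> nj; have nj' : (0 < nb_shift j n)%N.
    by rewrite /nb_shift [(j <= 1)%N]leqNgt j1.
  congr (_ * _); rewrite /bell_term (shift_up_ord0 kK nk nj').
  have -> : (j == 0 :> nat) = false by lia.
  by rewrite addn0; apply: A_perm; exact: (perm_args_shift2 kK nk j1 nj).
under [RHS]eq_bigr => j _ do rewrite -/(g j).
clearbody g; move: nKK g g_small g_big; clear nK.
case: K kK n nk => // K' kK n nk nKK g g_small g_big.
(* On the left, slot 0 yields no argument and the last slot is empty, as its weight exceeds [k]. On
   the right, [j = 0] and [j = 1] give the first two terms; then slot i+1 pairs with [j] = i+2. *)
rewrite big_ord_recl big_ord_recr /=.
have -> : lift ord0 ord_max = ord_max :> 'I_K'.+2 by exact/val_inj.
rewrite nKK muln0 mul0n mulr0n addr0 add0r.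
rewrite [RHS]big_ord_recl [X in _ = _ + X]big_ord_recl addrA.
rewrite !g_small //= addn0 addn1; congr (_ + _).
apply: eq_bigr => i _; rewrite g_big // -[LHS]mulr_natl.
have E : inord (lift ord0 (lift ord0 i)).-1 =
    lift ord0 (widen_ord (leqnSn K') i) :> 'I_K'.+2.
  have := ltn_ord i => ?; apply: ord_inj.
  by rewrite inordK /= /bump /= ?add1n ?add0n//; lia.
by rewrite E mul1n.
Qed.

Definition part_args k (c : {ffun 'I_k.+1 -> 'I_k.+1}) (b : nat) : seq nat :=
  flatten [seq nseq (nb_args c b i) (i : nat) | i : 'I_k.+1 <- enum 'I_k.+1].

End BellRecurrence.

(** * From multiplicities to partitions *)

Section PartitionSum.
Variables (F : realType) (k : nat) (A : nat -> seq nat -> F).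
Hypothesis k_gt1 : (1 < k)%N.
Local Notation T := {ffun 'I_k.+1 -> 'I_k.+1}.
Implicit Types (n c : T).

(** A pair (c, b) still counts the b beta-derivatives among its parts equal to 1, whereas n keeps
    them in slot 0. Hence c_1 = n_1 + n_0 and c_0 = 0, and the weight is unchanged because slot 0
    weighs 1. *)
Definition mult_of (p : T * 'I_k.+1) : T :=
  [ffun i => if i == ord0 then p.2 else inord (nb_args p.1 p.2 i)].
Definition part_of n : T * 'I_k.+1 :=
  ([ffun i => if i == ord0 then ord0 else
              inord (n i + (if i == 1 :> nat then n ord0 else ord0 : 'I_k.+1))],
   n ord0).

Lemma mult1E c : mult1 c = c (inord 1).
Proof.
rewrite /mult1 (big_pred1 (inord 1))// => i.
by rewrite /= -[RHS]val_eqE /= inordK// ltnS ltnW.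
Qed.



Lemma val_inord1 : (inord 1 : 'I_k.+1) = 1%N :> nat.
Proof. by rewrite inordK// ltnS ltnW. Qed.

Lemma eq_inord1 (i : 'I_k.+1) : (i == inord 1) = (i == 1%N :> nat).
Proof. by rewrite -val_eqE /= val_inord1. Qed.

Lemma nb_argsE c b i :
  nb_args c b i = (c i - (if i == inord 1 then b else 0))%N.
Proof. by rewrite /nb_args eq_inord1. Qed.

Lemma sum_ord1 (f : 'I_k.+1 -> nat) (b : nat) :
  (\sum_i f i * (if i == inord 1 then b else 0) = f (inord 1) * b)%N.
Proof.
rewrite (bigD1 (inord 1))//= eqxx big1 ?addn0// => i /negPf->.
by rewrite muln0.
Qed.

Lemma sum_ord0 (f : 'I_k.+1 -> nat) (b : nat) :
  (\sum_i f i * (if i == ord0 then b else 0) = f ord0 * b)%N.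
Proof.
rewrite (bigD1 ord0)//= ?eqxx big1 ?addn0// => i /negPf->.
by rewrite muln0.
Qed.

Lemma part_ofE n i : weight n == k ->
  ((part_of n).1 i + (if i == ord0 then n ord0 : nat else 0) =
   n i + (if i == inord 1 then n ord0 : nat else 0))%N.
Proof.
move=> /eqP nk; rewrite ffunE.
have [->|i0] := eqVneq i ord0.
  by rewrite eq_inord1 /= addn0.
rewrite addn0 eq_inord1 inordK; last first.
  case: eqP => [i1|_] /=; last by rewrite addn0.
  have := leq_weight2 n i0; rewrite nk /part_weight i1 /=; lia.
by case: eqP.
Qed.

Lemma mult_ofE (p : T * 'I_k.+1) i : nontrivial_partition p.1 ->
  (p.2 < (mult1 p.1).+1)%N ->
  (mult_of p i + (if i == inord 1 then p.2 : nat else 0) =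
   p.1 i + (if i == ord0 then p.2 : nat else 0))%N.
Proof.
move=> /and3P[/eqP c0 _ _]; rewrite mult1E ltnS ffunE => b1.
have [->|i0] := eqVneq i ord0.
  by rewrite c0 eq_inord1 /= addn0.
rewrite inordK nb_argsE; last by rewrite (leq_ltn_trans (leq_subr _ _)).
by case: eqP => [->|_]; rewrite ?addn0 ?subn0// subnK.
Qed.

Lemma part_ofP n : weight n == k -> n ord_max == 0 :> nat ->
  [/\ nontrivial_partition (part_of n).1,
      ((part_of n).2 < (mult1 (part_of n).1).+1)%N &
      mult_of (part_of n) = n].
Proof.
move=> nk nmax; have E i := part_ofE i nk.
have b1 : ((part_of n).2 < (mult1 (part_of n).1).+1)%N.
  rewrite mult1E ltnS; have := E (inord 1); rewrite eqxx.
  by rewrite [inord 1 == ord0]eq_sym eq_inord1 /=; lia.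
have nt : nontrivial_partition (part_of n).1.
  apply/and3P; split.
  - by have := E ord0; rewrite eqxx eq_inord1 /= addn0; lia.
  - have : (\sum_(i < k.+1) ((part_of n).1 i * i) +
        \sum_(i < k.+1) (part_weight i) * (if i == ord0 then n ord0 : nat else 0) =
        weight n +
        \sum_(i < k.+1) i * (if i == inord 1 then n ord0 : nat else 0))%N.
      rewrite -!big_split /=; apply: eq_bigr => i _.
      rewrite mulnC; move: (E i); have [->|i0] := eqVneq i ord0.
        by rewrite -val_eqE /= val_inord1 /part_weight /=; lia.
      have -> : part_weight i = i.
        by move: i0; rewrite -val_eqE /= /part_weight; case: (nat_of_ord i).
      by rewrite -!mulnDr => ->.
    rewrite sum_ord0 sum_ord1 val_inord1 (eqP nk) /part_weight /=; lia.
  - have := E ord_max; rewrite (eqP nmax) eq_inord1 -!val_eqE /=.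
    have -> : (k == 1)%N = false by lia.
    have -> : (k == 0)%N = false by lia.
    by rewrite !addn0 => ->.
split => //; apply/ffunP => i; apply/val_inj.
by have := mult_ofE i nt b1; have := E i; rewrite /=; lia.
Qed.

Lemma mult_ofP (p : T * 'I_k.+1) : nontrivial_partition p.1 -> (p.2 < (mult1 p.1).+1)%N ->
  [/\ weight (mult_of p) == k, mult_of p ord_max == 0 :> nat &
      part_of (mult_of p) = p].
Proof.
move=> nt b1; have E i := mult_ofE i nt b1.
have /and3P[c0 ck cm] := nt.
have nk : weight (mult_of p) == k.
  have : (\sum_(i < k.+1) (p.1 i * i) +
        \sum_(i < k.+1) (part_weight i) * (if i == ord0 then p.2 : nat else 0) =
        weight (mult_of p) +
        \sum_(i < k.+1) i * (if i == inord 1 then p.2 : nat else 0))%N.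
    rewrite -!big_split /=; apply: eq_bigr => i _.
    rewrite mulnC; move: (E i); have [->|i0] := eqVneq i ord0.
      by rewrite (eqP c0) -val_eqE /= val_inord1 /part_weight /=; lia.
    have -> : part_weight i = i.
      by move: i0; rewrite -val_eqE /= /part_weight; case: (nat_of_ord i).
    by rewrite -!mulnDr => ->.
  rewrite sum_ord0 sum_ord1 val_inord1 (eqP ck) /part_weight /=; lia.
split => //.
  have := E ord_max; rewrite (eqP cm) eq_inord1 -!val_eqE /=.
  have -> : (k == 1)%N = false by lia.
    have -> : (k == 0)%N = false by lia.
  by rewrite !addn0 => ->.
have p2 : (part_of (mult_of p)).2 = p.2 by rewrite /= ffunE eqxx.
rewrite [LHS]surjective_pairing [RHS]surjective_pairing p2; congr pair.
apply/ffunP => i; apply/val_inj; have := part_ofE i nk; have := E i.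
have -> : mult_of p ord0 = p.2 by rewrite ffunE eqxx.
by rewrite /=; lia.
Qed.

Lemma nb_args_part_of n i : weight n == k -> n ord_max == 0 :> nat ->
  nb_args (part_of n).1 (part_of n).2 i = ((i != 0 :> nat) * n i)%N.
Proof.
move=> nk nmax; have [nt b1 e] := part_ofP nk nmax.
have := part_ofE i nk; rewrite nb_argsE /= -[i != 0 :> nat]/(i != ord0).
have [->|i0] := eqVneq i ord0.
  by rewrite eq_inord1 /=; lia.
by rewrite addn0 mul1n /= => ->; rewrite addnK.
Qed.

(** The exponents c_i and n_i of i! differ only for i = 0 and i = 1, where i! = 1; slot 0 supplies
    b!. *)
Lemma partition_coef_part_of n : weight n == k -> n ord_max == 0 :> nat ->
  partition_coef (part_of n).1 (part_of n).2 =
  k`!%:R * (fact_prod n)%:R^-1 :> F.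
Proof.
move=> nk nmax; rewrite /partition_coef; congr (_ * _%:R^-1).
rewrite /fact_prod /=.
rewrite (bigD1 ord0)//= [in RHS](bigD1 ord0)//=.
rewrite nb_args_part_of//= fact0 mul1n exp1n mul1n exp1n muln1.
congr (_ * _)%N; apply: eq_bigr => i i0.
rewrite (nb_args_part_of i nk nmax) -[i != 0 :> nat]/(i != ord0) i0 mul1n.
have := part_ofE i nk; rewrite (negPf i0) addn0 => ->.
case: eqP => [->|_]; last by rewrite addn0.
by rewrite val_inord1 !exp1n.
Qed.

Definition single_part : T :=
  [ffun i => if i == ord_max then inord 1 else ord0].

(** One part [k] already has weight [k], which leaves nothing for the other slots, all of positive
    weight. *)
Lemma single_partP n :
  (weight n == k) && (n ord_max != 0 :> nat) = (n == single_part).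
Proof.
have wk : part_weight k = k by rewrite /part_weight; lia.
apply/andP/eqP => [[/eqP nk nm]|->].
  have /eqP n1 : (n ord_max == 1 :> nat)%N.
    by have := leq_weight n ord_max; rewrite nk /= wk; nia.
  apply/ffunP => i; apply/val_inj; rewrite ffunE.
  have [->|im] := eqVneq i ord_max; first by rewrite /= n1 val_inord1.
  have := leq_weight2 n im; rewrite nk /= wk n1; have := part_weight_gt0 i.
  by move=> ? ?; rewrite /=; nia.
rewrite /weight (bigD1 ord_max) //= ffunE eqxx val_inord1 muln1 wk.
by rewrite big1 ?addn0 ?eqxx// => i /negPf im; rewrite ffunE im muln0.
Qed.

Lemma args_single_part : args_of single_part = [:: k].
Proof.
rewrite /args_of enum_ordSr map_rcons flatten_rcons /= ffunE eqxx val_inord1.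
have -> : (k != 0)%N by lia.
rewrite mul1n /=; set s := flatten _; suff -> : s = [::] by [].
rewrite /s -map_comp /=; elim: (enum _) => //= i l ->.
rewrite ffunE -val_eqE /= cats0 (ltn_eqF (ltn_ord i)).
by rewrite muln0.
Qed.

Lemma fact_prod_single_part : fact_prod single_part = k`!.
Proof.
rewrite /fact_prod (bigD1 ord_max)//= ffunE eqxx val_inord1 expn1 mul1n.
by rewrite big1 ?muln1// => i /negPf im; rewrite ffunE im.
Qed.

(** Isolates the one term containing the k-th derivative of the path; the others form the sum in
    [deriv_rhs]. *)
Lemma bell_sum_partition :
  k`!%:R * bell_sum k A k =
  A 0 [:: k] + \sum_(c : T | nontrivial_partition c) \sum_(b < (mult1 c).+1)
     partition_coef c b * A b (part_args c b).
Proof.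
rewrite /bell_sum mulr_sumr (bigID (fun n => n ord_max != 0 :> nat)) /=.
rewrite (big_pred1 single_part); last exact: single_partP.
congr (_ + _).
  rewrite /bell_term args_single_part fact_prod_single_part mulVKf.
    by rewrite ffunE -val_eqE /=; case: (k) k_gt1.
  by rewrite pnatr_eq0 -lt0n fact_gt0.
symmetry.
transitivity (\sum_(c : T | nontrivial_partition c)
   \sum_(b < k.+1 | (b < (mult1 c).+1)%N)
     partition_coef c b * A b (part_args c b)).
  apply: eq_bigr => c _; rewrite (big_ord_widen k.+1
    (fun b : nat => partition_coef c b * A b (part_args c b)))//.
  by rewrite mult1E ltn_ord.
rewrite pair_big_dep /=; apply: (sum_bij (h := part_of) (h' := mult_of)).
- by move=> n; rewrite negbK => /andP[nk nm]; have [-> -> ->] := part_ofP nk nm.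
- move=> p /andP[nt b1]; rewrite negbK.
  by have [-> -> ->] := mult_ofP nt b1.
move=> n; rewrite negbK => /andP[nk nm].
rewrite partition_coef_part_of// mulrA; congr (_ * A _ _).
rewrite /part_args /args_of; congr flatten; apply: eq_map => i.
by rewrite nb_args_part_of.
Qed.
End PartitionSum.


(** * Rational expressions in r and exponentials of beta *)

Lemma is_derive_bigsum (R : realType) (I : Type) (s : seq I) (P : pred I)
    (f : I -> R -> R) (df : I -> R) (t : R) :
  (forall i, P i -> is_derive t 1 (f i) (df i)) ->
  is_derive t 1 (fun u => \sum_(i <- s | P i) f i u) (\sum_(i <- s | P i) df i).
Proof.
move=> H; rewrite -fct_sumE.
apply: (big_ind2 (fun (g : R -> R) dg => is_derive t 1 g dg)) => //.
  exact: is_derive_cst.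
by move=> g1 dg1 g2 dg2 *; exact: is_deriveD.
Qed.

(* The components of [FBA] are values of such expressions. Their formal partial
   derivatives commute by plain algebra, so that no Schwarz theorem is needed;
   [None] stands for the variable beta. *)
Section Expressions.
Context {R : realType} {M : nat}.
Implicit Types (r : 'rV[R]_M) (b : R) (o : option 'I_M).

Inductive expr : Type :=
| Cst of R
| Var of 'I_M
| Exp of R
| Add of expr & expr
| Mul of expr & expr
| Inv of expr.

Fixpoint eval (e : expr) r b : R :=
  match e with
  | Cst c => c
  | Var i => r 0 i
  | Exp a => expR (- (b * a))
  | Add e1 e2 => eval e1 r b + eval e2 r b
  | Mul e1 e2 => eval e1 r b * eval e2 r b
  | Inv e1 => (eval e1 r b)^-1
  end.

Fixpoint pderiv o (e : expr) : expr :=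
  match e with
  | Cst _ => Cst 0
  | Var i => Cst (o == Some i)%:R
  | Exp a => Mul (Cst (if o is None then - a else 0)) (Exp a)
  | Add e1 e2 => Add (pderiv o e1) (pderiv o e2)
  | Mul e1 e2 => Add (Mul (pderiv o e1) e2) (Mul e1 (pderiv o e2))
  | Inv e1 => Mul (Cst (-1)) (Mul (pderiv o e1) (Mul (Inv e1) (Inv e1)))
  end.

(** Used with [P] meaning nonzero at a point, nonzero on full support, or bounded away from 0 on a
    set. Differentiation inverts nothing new, so all partial derivatives inherit it. *)
Fixpoint inverted (P : (('rV[R]_M -> R -> R) : Type) -> Prop) (e : expr) : Prop :=
  match e with
  | Add e1 e2 | Mul e1 e2 => inverted P e1 /\ inverted P e2
  | Inv e1 => P (eval e1) /\ inverted P e1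
  | _ => True
  end.

Lemma inverted_pderiv P o e : inverted P e -> inverted P (pderiv o e).
Proof. by elim: e => //= [e1 H1 e2 H2|e1 H1 e2 H2|e1 H1] [] /=; tauto. Qed.

Lemma inverted_sub (P Q : ('rV[R]_M -> R -> R) -> Prop) e :
  (forall f, P f -> Q f) -> inverted P e -> inverted Q e.
Proof. by move=> PQ; elim: e => //= [e1 H1 e2 H2|e1 H1 e2 H2|e1 H1] []; auto. Qed.

Lemma eval_pderivC o o' e r b :
  eval (pderiv o (pderiv o' e)) r b = eval (pderiv o' (pderiv o e)) r b.
Proof.
elim: e => /= [|||e1 -> e2 ->|e1 H1 e2 H2|e1 H1] //.
- by move=> a; ring.
- by rewrite H1 H2; ring.
- by rewrite H1; ring.
Qed.

Lemma is_derive_eval e (y : R -> 'rV[R]_M) (bt : R -> R) (t : R)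
    (dy : 'rV[R]_M) (db : R) :
  (forall i, is_derive t 1 (fun s => y s 0 i) (dy 0 i)) ->
  is_derive t 1 bt db ->
  inverted (fun f => f (y t) (bt t) != 0) e ->
  is_derive t 1 (fun s => eval e (y s) (bt s))
    (\sum_i dy 0 i * eval (pderiv (Some i) e) (y t) (bt t)
     + db * eval (pderiv None e) (y t) (bt t)).
Proof.
move=> dyi dbt; elim: e => /= [c|i|a|e1 H1 e2 H2|e1 H1 e2 H2|e1 H1].
- move=> _; apply: is_derive_eq; rewrite big1 ?mulr0 ?addr0// => i _.
  by rewrite mulr0.
- move=> _; apply: is_derive_eq.
  rewrite mulr0 addr0 (bigD1 i)//= eqxx mulr1 big1 ?addr0// => j ji.
  by rewrite (inj_eq Some_inj) (negPf ji) mulr0.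
- move=> _.
  have : is_derive t 1 (expR \o (fun s => - (bt s * a)))
    (expR (- (bt t * a)) * (- (bt t *: 0 + a *: db))).
    by apply: is_derive1_comp.
  move=> H; apply: is_derive_eq; rewrite big1 ?add0r => [|i _].
    by rewrite scaler0 add0r; rewrite /GRing.scale /=; ring.
  by rewrite mul0r mulr0.
- move=> [/H1 d1 /H2 d2]; apply: is_derive_eq.
  rewrite mulrDr addrACA; congr (_ + _); rewrite -big_split /=.
  by apply: eq_bigr => i _; rewrite mulrDr.
- move=> [/H1 d1 /H2 d2].
  apply: (@is_derive_eq _ _ _ _ _ _ _ _ (is_deriveM d1 d2)).
  rewrite /GRing.scale /= !mulrDr !mulr_sumr addrACA -big_split /=.
  by congr (_ + _); last ring; apply: eq_bigr => i _; ring.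
- move=> [n0 /H1 d1].
  have dV := is_deriveV (f := fun s => eval e1 (y s) (bt s)) n0 d1.
  apply: is_derive_eq dV _.
  rewrite /GRing.scale /= mulrDr mulr_sumr; congr (_ + _).
    by apply: eq_bigr => i _; rewrite expr2 invfM; ring.
  by rewrite expr2 invfM; ring.
Qed.


Definition full_support r : Prop := forall i, 0 < r 0 i.

Definition regular := inverted (fun f => forall r b, full_support r -> f r b != 0).

Definition eq_eval (e e' : expr) : Prop :=
  forall r b, full_support r -> eval e r b = eval e' r b.

Lemma regular_inverted e r b : regular e -> full_support r ->
  inverted (fun f => f r b != 0) e.
Proof. by move=> re pr; apply: inverted_sub re => f; apply. Qed.

Lemma is_derive_line r (v : 'rV[R]_M) i :
  is_derive (0 : R) 1 (fun s : R => (s *: v + r) 0 i) (v 0 i).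
Proof.
have -> : (fun s : R => (s *: v + r) 0 i) =
          (fun s : R => s * v 0 i + r 0 i).
  by apply/funext => s; rewrite !mxE.
by apply: is_derive_eq; rewrite addr0 scaler0 add0r /GRing.scale /= mulr1.
Qed.

Lemma near_full_support_line r (v : 'rV[R]_M) : full_support r ->
  \forall s \near (0 : R), full_support (s *: v + r).
Proof.
move=> pr.
suff H i : \forall s \near (0 : R), 0 < (s *: v + r) 0 i.
  exact: (filter_forall _ H).
have dc : (s *: v + r) 0 i @[s --> (0 : R)] --> (0 *: v + r) 0 i.
  have [/derivable1_diffP + _] := is_derive_line r v i.
  exact: differentiable_continuous.
rewrite scale0r add0r in dc.
exact: cvgr_gt dc _ (pr i).
Qed.

Lemma is_derive_eval_r e r b (v : 'rV[R]_M) : regular e -> full_support r ->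
  is_derive (0 : R) 1 (fun s : R => eval e (s *: v + r) b)
    (\sum_i v 0 i * eval (pderiv (Some i) e) r b).
Proof.
move=> re pr.
have := @is_derive_eval e (fun s : R => s *: v + r) (cst b) 0 v 0
  (is_derive_line r v) (is_derive_cst _ _ _).
rewrite mul0r addr0 scale0r add0r; apply; exact: regular_inverted.
Qed.

Lemma is_derive_eval_b e r b : regular e -> full_support r ->
  is_derive b 1 (eval e r) (eval (pderiv None e) r b).
Proof.
move=> re pr.
have H i : is_derive b 1 (fun s : R => (cst r s) 0 i) ((0 : 'rV[R]_M) 0 i).
  by rewrite mxE; exact: is_derive_cst.
have := @is_derive_eval e (cst r) id b 0 1 H (is_derive_id _ _).
rewrite big1 ?add0r ?mul1r; last by move=> i _; rewrite mxE mul0r.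
apply; exact: regular_inverted.
Qed.

Lemma sum_delta (i : 'I_M) (f : 'I_M -> R) :
  \sum_j (delta_mx 0 i : 'rV[R]_M) 0 j * f j = f i.
Proof.
rewrite (bigD1 i)//= mxE !eqxx mul1r big1 ?addr0// => j ji.
by rewrite mxE (negPf ji) andbF mul0r.
Qed.

(** [pderiv] is syntactic, so equality of values does not pass through it by itself. Full support is
    an open condition, hence expressions that agree there have the same true derivatives. This
    allows [eval_pderivC] to be used under further derivatives. *)
Lemma eq_eval_pderiv o e e' : regular e -> regular e' -> eq_eval e e' ->
  eq_eval (pderiv o e) (pderiv o e').
Proof.
move=> re re' ee r b pr; case: o => [i|].
  have := is_derive_eval_r b (delta_mx 0 i) re pr.
  have := is_derive_eval_r b (delta_mx 0 i) re' pr.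
  rewrite !sum_delta => -[_ <-] [_ <-]; apply: near_eq_derive.
  by apply: filterS (near_full_support_line (delta_mx 0 i) pr) => s; apply: ee.
have [_ <-] := is_derive_eval_b b re pr.
have [_ <-] := is_derive_eval_b b re' pr.
by congr ('D_1 _ b); apply/funext => s; apply: ee.
Qed.

Lemma regular_pderiv o e : regular e -> regular (pderiv o e).
Proof. exact: inverted_pderiv. Qed.
#[local] Hint Resolve regular_pderiv : core.

Lemma regular_pderivs (s : seq (option 'I_M)) e : regular e -> regular (foldr pderiv e s).
Proof. by move=> re; elim: s => //= o s; apply: regular_pderiv. Qed.

Lemma eq_eval_pderivs (s : seq (option 'I_M)) o e : regular e ->
  eq_eval (pderiv o (foldr pderiv e s)) (foldr pderiv (pderiv o e) s).
Proof.
move=> re; elim: s => [|o' s IH] //= r b pr.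
rewrite eval_pderivC; apply: eq_eval_pderiv => //.
  exact/regular_pderiv/regular_pderivs.
exact/regular_pderivs/regular_pderiv.
Qed.

(** [Dform] unrolled one argument at a time, the shape needed for induction on the arguments; see
    [Dform_dirderiv]. *)
Fixpoint dirderiv e (vs : seq 'rV[R]_M) r b : R :=
  if vs is v :: vs' then \sum_i v 0 i * dirderiv (pderiv (Some i) e) vs' r b
  else eval e r b.

Lemma eq_eval_dirderiv e e' vs r b : regular e -> regular e' -> eq_eval e e' ->
  full_support r -> dirderiv e vs r b = dirderiv e' vs r b.
Proof.
move=> + + + pr; elim: vs e e' => [|v vs IH] e e' re re' ee /=; first exact: ee.
apply: eq_bigr => i _; congr (_ * _); apply: IH; auto.
exact: eq_eval_pderiv.
Qed.

Lemma dirderiv_swap e v w vs r b : regular e -> full_support r ->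
  dirderiv e (v :: w :: vs) r b = dirderiv e (w :: v :: vs) r b.
Proof.
move=> re pr /=; under eq_bigr => i _ do rewrite mulr_sumr.
rewrite exchange_big /=; apply: eq_bigr => i _; rewrite mulr_sumr.
apply: eq_bigr => j _; rewrite mulrCA; congr (_ * (_ * _)).
apply: eq_eval_dirderiv => //; auto.
by move=> ? ? _; exact: eval_pderivC.
Qed.

Lemma dirderiv_catCA e v vs vs' r b : regular e -> full_support r ->
  dirderiv e (vs ++ v :: vs') r b = dirderiv e (v :: vs ++ vs') r b.
Proof.
move=> + pr; elim: vs e => //= w vs IH e re.
rewrite -[RHS]/(dirderiv e (v :: w :: vs ++ vs') r b) dirderiv_swap//=.
by apply: eq_bigr => i _; rewrite IH; auto.
Qed.

Lemma dirderiv_perm (I : eqType) e (v : I -> 'rV[R]_M) (s s' : seq I) r b :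
  regular e -> full_support r -> perm_eq s s' ->
  dirderiv e (map v s) r b = dirderiv e (map v s') r b.
Proof.
move=> + pr; elim: s s' e => [|x s IH] s' e re ss'.
  by move: ss'; rewrite perm_sym => /perm_nilP ->.
have /path.splitPr xs' : x \in s' by rewrite -(perm_mem ss') mem_head.
case: xs' ss' => s1 s2; rewrite perm_sym perm_catC /= perm_cons perm_catC => ss'.
rewrite map_cat /= dirderiv_catCA// -map_cat /=; apply: eq_bigr => i _.
by rewrite (IH (s1 ++ s2)) //; auto; rewrite perm_sym.
Qed.

Lemma big_cons_tuple (V : nmodType) (I : finType) m (f : seq I -> V) :
  \sum_(s : m.+1.-tuple I) f s = \sum_i \sum_(s : m.-tuple I) f (i :: s).
Proof.
rewrite pair_big /=.
rewrite (reindex (fun p : I * m.-tuple I => [tuple of p.1 :: p.2])) //=.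
exists (fun t : m.+1.-tuple I => (thead t, [tuple of behead t])).
  by move=> [i s] _ /=; congr pair; apply/val_inj.
by move=> t _ /=; rewrite -tuple_eta.
Qed.

Lemma dirderiv_tuples e (vs : seq 'rV[R]_M) r b : regular e -> full_support r ->
  \sum_(s : (size vs).-tuple 'I_M) (\prod_(t < size vs) vs`_t 0 (tnth s t)) *
     eval (foldr (fun i => pderiv (Some i)) e s) r b = dirderiv e vs r b.
Proof.
move=> + pr; elim: vs e => [|v vs IH] e re /=.
  rewrite (big_pred1 [tuple]); last first.
    by move=> t; rewrite /= [t]tuple0; apply/esym/eqP; apply: val_inj.
  by rewrite big_ord0 mul1r.
(* A function of plain sequences, as [big_cons_tuple] requires; the match only supplies a default
   for [nth]. *)
pose f (s : seq 'I_M) := (\prod_(t < (size vs).+1)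
  if s is i :: s' then (v :: vs)`_t 0 (nth i s t) else 1) *
  eval (foldr (fun i => pderiv (Some i)) e s) r b.
transitivity (\sum_(s : (size vs).+1.-tuple 'I_M) f s).
  apply: eq_bigr => s _; rewrite /f; congr (_ * _).
  apply: eq_bigr => t _; case: s => -[//|i s] si.
  by rewrite (tnth_nth i).
rewrite big_cons_tuple; apply: eq_bigr => i _.
rewrite -IH; last exact: regular_pderiv.
rewrite mulr_sumr; apply: eq_bigr => s _.
rewrite /f big_ord_recl /= -mulrA; congr (_ * (_ * _)).
  by apply: eq_bigr => t _; rewrite (tnth_nth i).
(* [foldr] puts the derivative in [i] outermost, [dirderiv] innermost, so the two have to be
   commuted. *)
have E e' : foldr (fun i => pderiv (Some i)) e' s = foldr pderiv e' (map Some s).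
  by elim: (tval s) => //= j s' ->.
by rewrite !E; exact: eq_eval_pderivs.
Qed.

(** The product rule in three groups, as in [bell_sumS]: the explicit beta, r along the path (with
    derivative [v 1]), and each argument in turn, [q] becoming [q.+1]. *)
Lemma is_derive_dirderiv e (v : nat -> R -> 'rV[R]_M) (s : seq nat) (b : R) :
  regular e -> full_support (v 0%N b) ->
  (forall p i, is_derive b 1 (fun t => v p t 0 i) (v p.+1 b 0 i)) ->
  let A e s := dirderiv e [seq v p b | p <- s] (v 0%N b) b in
  is_derive b 1 (fun t => dirderiv e [seq v p t | p <- s] (v 0%N t) t)
   (A (pderiv None e) s + A e (1%N :: s) + \sum_(q <- s) A e (q.+1 :: rem q s)).
Proof.
move=> + pv dv A; elim: s e => [|p s IH] e re.
  rewrite big_nil addr0 /A /= [X in is_derive _ _ _ X]addrC -[X in _ + X]mul1r.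
  by apply: is_derive_eval => //; apply: regular_inverted.
rewrite /=.
have H i : is_derive b 1
    (fun t => v p t 0 i * dirderiv (pderiv (Some i) e) [seq v p t | p <- s] (v 0%N t) t)
    (v p b 0 i * (A (pderiv None (pderiv (Some i) e)) s +
       A (pderiv (Some i) e) (1%N :: s) +
       \sum_(q <- s) A (pderiv (Some i) e) (q.+1 :: rem q s)) +
     A (pderiv (Some i) e) s * v p.+1 b 0 i).
  have dIH := IH _ (regular_pderiv (Some i) re).
  apply: (@is_derive_eq _ _ _ _ _ _ _ _ (is_deriveM (dv p i) dIH)).
  by [].
have {}H := is_derive_bigsum (index_enum 'I_M) (P := xpredT) (fun i _ => H i).
apply: (is_derive_eq H).
rewrite !big_split /= big_cons eqxx.
under eq_bigr => i _ do rewrite !mulrDr.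
rewrite !big_split /=.
have -> : \sum_(i < M) v p b 0 i * A (pderiv None (pderiv (Some i) e)) s =
    A (pderiv None e) (p :: s).
  apply: eq_bigr => i _; congr (_ * _); apply: eq_eval_dirderiv; auto.
  by move=> ? ? _; exact: eval_pderivC.
have -> : \sum_(i < M) v p b 0 i * A (pderiv (Some i) e) (1%N :: s) =
    A e (1%N :: p :: s).
  by rewrite [RHS]dirderiv_swap.
rewrite -!addrA; congr (_ + (_ + _)); rewrite addrC; congr (_ + _).
  by apply: eq_bigr => i _; rewrite mulrC.
under eq_bigr => i _ do rewrite mulr_sumr.
rewrite exchange_big /=; apply: eq_big_seq => q qs.
have -> : A e (q.+1 :: (if p == q then s else p :: rem q s)) =
          A e (p :: q.+1 :: rem q s).
  apply: dirderiv_perm => //; rewrite -[X in perm_eq _ X]/([:: p] ++ [:: q.+1] ++ rem q s).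
  rewrite perm_sym perm_catCA /= perm_cons.
  by have [->|//] := eqVneq p q; rewrite perm_sym perm_to_rem.
by [].
Qed.


End Expressions.


(** * Numerical derivatives on a path of roots *)

Section Represented.
Context {R : realType} {M : nat}.
Implicit Types (r : 'rV[R]_M) (b : R) (G : 'rV[R]_M -> R -> 'rV[R]_M)
  (E : 'I_M -> @expr R M).

Definition represents G E : Prop :=
  forall r b j, full_support r -> G r b 0 j = eval (E j) r b.

Lemma is_derive_along (V W : normedModType R) (f : V -> W) x v df :
  is_derive (0 : R) 1 (fun h => f (h *: v + x)) df -> is_derive x v f df.
Proof.
move=> [df1 H]; have dv : derivable f x v by apply/derivable1P.
apply: (DeriveDef dv); rewrite -H.
rewrite /derive; set g1 := fun h => h^-1 *: _; set g2 := fun h => h^-1 *: _.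
suff -> : g1 = g2 by [].
by apply/funext => h; rewrite /g1 /g2 /= addr0 scale0r add0r [_%:A]mulr1.
Qed.

Lemma is_derive_mx (V : normedModType R) m n (f : V -> 'M[R]_(m, n)) x v
    (df : 'M[R]_(m, n)) :
  (forall i j, is_derive x v (fun u => f u i j) (df i j)) -> is_derive x v f df.
Proof.
move=> H; have fx : derivable f x v.
  by apply/derivable_mxP => i j; case: (H i j).
apply: DeriveDef => //; rewrite derive_mx//; apply/matrixP => i j; rewrite mxE.
by case: (H i j).
Qed.

Lemma is_derive_mx_coord (V : normedModType R) (f : V -> 'rV[R]_M) x v j :
  derivable f x v -> is_derive x v (fun u => f u 0 j) ('D_v f x 0 j).
Proof.
move=> fx; rewrite derive_mx// mxE; apply: derivableP.
exact: ((derivable_mxP f x v).1 fx).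
Qed.

Lemma is_derive_represented_r G E r b (v : 'rV[R]_M) :
  represents G E -> (forall j, regular (E j)) -> full_support r ->
  is_derive r v (fun r' => G r' b)
    (\row_j \sum_i v 0 i * eval (pderiv (Some i) (E j)) r b).
Proof.
move=> GE rE pr; apply: is_derive_mx => i j; rewrite (ord1 i) mxE.
apply: is_derive_along; apply: near_eq_is_derive (is_derive_eval_r b v (rE j) pr).
by apply: filterS (near_full_support_line v pr) => s ps; rewrite GE.
Qed.

Lemma represents_partial_r G E i :
  represents G E -> (forall j, regular (E j)) ->
  represents (partial_r i G) (fun j => pderiv (Some i) (E j)).
Proof.
move=> GE rE r b j pr; rewrite /partial_r.
have [_ ->] := is_derive_represented_r b (delta_mx 0 i) GE rE pr.
by rewrite mxE sum_delta.
Qed.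

Lemma represents_partial_beta G E :
  represents G E -> (forall j, regular (E j)) ->
  represents (partial_beta G) (fun j => pderiv None (E j)).
Proof.
move=> GE rE r b j pr; rewrite /partial_beta derive1E.
have : is_derive b 1 (G r) (\row_j eval (pderiv None (E j)) r b).
  apply: is_derive_mx => i k; rewrite (ord1 i) mxE.
  have -> : (fun u => G r u 0 k) = eval (E k) r.
    by apply/funext => u; rewrite GE.
  exact: is_derive_eval_b.
by move=> [_ ->]; rewrite mxE.
Qed.

Lemma regular_iter c (e : @expr R M) : regular e -> regular (iter c (pderiv None) e).
Proof. by move=> re; elim: c => //= c; apply: regular_pderiv. Qed.

Lemma regular_foldr (s : seq 'I_M) (e : @expr R M) :
  regular e -> regular (foldr (fun i => pderiv (Some i)) e s).
Proof. by move=> re; elim: s => //= i s; apply: regular_pderiv. Qed.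

Lemma represents_mixed_partial G E c s :
  represents G E -> (forall j, regular (E j)) ->
  represents (mixed_partial G c s)
    (fun j => foldr (fun i => pderiv (Some i)) (iter c (pderiv None) (E j)) s).
Proof.
move=> GE rE; elim: s => [|i s IH] /=.
  elim: c => [|c IH] //=; apply: represents_partial_beta => // j.
  exact: regular_iter.
apply: represents_partial_r => // j.
exact/regular_foldr/regular_iter.
Qed.

Lemma Dform_dirderiv G E r b c (vs : seq 'rV[R]_M) j :
  represents G E -> (forall j, regular (E j)) -> full_support r ->
  Dform G r b c vs 0 j = dirderiv (iter c (pderiv None) (E j)) vs r b.
Proof.
move=> GE rE pr; rewrite /Dform summxE -dirderiv_tuples//; last exact: regular_iter.
by apply: eq_bigr => s _; rewrite mxE (represents_mixed_partial _ _ GE).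
Qed.

Lemma jacobian_r_eval G E r b :
  represents G E -> (forall j, regular (E j)) -> full_support r ->
  jacobian_r G r b = \matrix_(i, j) eval (pderiv (Some i) (E j)) r b.
Proof.
move=> GE rE pr; apply/matrixP => i j; rewrite !mxE.
by rewrite (represents_partial_r _ GE).
Qed.

Section Path.
Variables (G : 'rV[R]_M -> R -> 'rV[R]_M) (E : 'I_M -> @expr R M).
Hypotheses (GE : represents G E) (rE : forall j, regular (E j)).
Variables (V : set R) (y : R -> 'rV[R]_M).
Hypotheses (openV : open V) (smooth_y : smooth_on V y).
Hypotheses (pos_y : forall t, V t -> full_support (y t)).
Hypotheses (root_y : forall t, V t -> G (y t) t = 0).

Let v (k : nat) : R -> 'rV[R]_M := y^`(k)%classic.

Lemma is_derive_derive1n k t i : V t ->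
  is_derive t 1 (fun u => v k u 0 i) (v k.+1 t 0 i).
Proof.
by move=> Vt; rewrite /v derive1nS derive1E; apply/is_derive_mx_coord/smooth_y.
Qed.

Definition path_term j (t : R) (c : nat) (s : seq nat) : R :=
  dirderiv (iter c (pderiv None) (E j)) [seq v k t | k <- s] (y t) t.

Lemma is_derive_bell_sum K k j t : V t -> (k < K)%N ->
  is_derive t 1 (fun u => bell_sum K (path_term j u) k)
    (k.+1%:R * bell_sum K (path_term j t) k.+1).
Proof.
move=> Vt kK.
rewrite -bell_sumS//; last first.
  move=> c s s' ss'; apply: dirderiv_perm => //; [exact: regular_iter|exact: pos_y].
apply: is_derive_bigsum => n _.
have re : regular (iter (n ord0) (pderiv None) (E j)) by exact: regular_iter.
have py : full_support (v 0%N t) by apply: pos_y.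
have H := is_derive_dirderiv (args_of n) re py
  (fun p i => is_derive_derive1n p i Vt).
apply: (is_derive_eq (is_deriveZ (fact_prod n)%:R^-1 H)).
by [].
Qed.

(** Differentiating the identity for [k], valid on the open set [V], gives k+1 times the identity
    for k+1; [k = 0] is the root equation. *)
Lemma bell_sum_root K k j t : V t -> (k <= K)%N ->
  bell_sum K (path_term j t) k = 0.
Proof.
elim: k t => [|k IH] t Vt kK.
  rewrite /bell_sum big1// => n /eqP n0.
  have nx x : n x = 0%N :> nat.
    have := leq_weight n x; rewrite n0 leqn0 muln_eq0.
    by rewrite eqn0Ngt part_weight_gt0 => /eqP.
  rewrite /bell_term /args_of.
  have -> : flatten [seq nseq ((i != 0%N :> nat) * n i) (i : nat) |
      i : 'I_K.+1 <- enum 'I_K.+1] = [::].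
    by elim: (enum _) => //= i l ->; rewrite nx muln0.
  by rewrite nx /path_term /= -GE ?root_y ?mxE ?mulr0//; apply: pos_y.
have [_ H1] := is_derive_bell_sum j Vt kK.
have : 'D_1 (fun u => bell_sum K (path_term j u) k) t = 'D_1 (cst 0) t.
  apply: near_eq_derive; have := open_nbhs_nbhs (conj openV Vt).
  by apply: filterS => u Vu; rewrite IH// ltnW.
rewrite H1 derive_cst => /eqP; rewrite mulf_eq0 pnatr_eq0 /= => /eqP //.
Qed.

Lemma mulmx_jacobian t w j : V t ->
  (w *m jacobian_r G (y t) t) 0 j = dirderiv (E j) [:: w] (y t) t.
Proof.
move=> Vt; rewrite (jacobian_r_eval _ GE)//; last exact: pos_y.
by rewrite mxE; apply: eq_bigr => i _; rewrite mxE.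
Qed.

Lemma derive1n_rhs t k : V t ->
  v k.+1 t *m jacobian_r G (y t) t =
  deriv_rhs G (y t) t k.+1 [seq v i.+1 t | i <- iota 0 k].
Proof.
move=> Vt; apply/rowP => j; rewrite mulmx_jacobian//.
have py := pos_y Vt.
(* Order 1 is a branch of its own in [deriv_rhs], outside the range of [bell_sum_partition]; there
   the chain rule is applied once. *)
case: k => [|k].
  rewrite /deriv_rhs /= mxE (represents_partial_beta GE)//.
  have := is_derive_dirderiv [::] (rE j) py (fun p i => is_derive_derive1n p i Vt).
  rewrite /= big_nil addr0 => -[_ H]; apply/eqP; rewrite -addr_eq0 addrC -H.
  have -> : 0 = 'D_1 (cst 0) t :> R by rewrite derive_cst.
  apply/eqP; apply: near_eq_derive.
  have := open_nbhs_nbhs (conj openV Vt); apply: filterS => u Vu /=.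
  by rewrite -GE ?root_y ?mxE//; apply: pos_y.
have := bell_sum_partition (path_term j t) (isT : 1 < k.+2)%N.
rewrite bell_sum_root// mulr0 => /esym /eqP; rewrite addr_eq0.
rewrite -[X in X = _]/(path_term j t 0 [:: k.+2]) => /eqP ->.
set vs := map _ _; rewrite /deriv_rhs /= mxE summxE; congr (- _); apply: eq_bigr => c nt.
rewrite summxE; apply: eq_bigr => b _; rewrite mxE (Dform_dirderiv _ _ _ _ GE)//.
congr (_ * _); rewrite /path_term; congr dirderiv.
rewrite /part_args /partition_args map_flatten -map_comp; congr flatten.
apply: eq_map => i /=; rewrite map_nseq.
(* Slots 0 and k+2 are empty, so only the orders 1, ..., k+1 listed in [vs] occur. *)
have /and3P[/eqP c0 _ /eqP cm] := nt.
have [i0|i0] := eqVneq i ord0; first by rewrite /nb_args i0 c0 sub0n.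
have [im|im] := eqVneq i ord_max; first by rewrite /nb_args im cm sub0n.
congr nseq; have {}i0 : i != 0%N :> nat by [].
have {}im : i != k.+2 :> nat by [].
have := ltn_ord i => iK.
rewrite /vs (nth_map 0%N) ?size_iota; last by lia.
by rewrite nth_iota ?add0n ?prednK//; lia.
Qed.

Lemma num_derivs_path t k : V t -> jacobian_r G (y t) t \in unitmx ->
  num_derivs G (y t) t k = [seq v i.+1 t | i <- iota 0 k].
Proof.
move=> Vt uJ; elim: k => [//|k IH].
rewrite -[X in iota 0 X]addn1 iotaD map_cat add0n /= cats1 IH.
by rewrite -derive1n_rhs// mulmxK.
Qed.

Lemma num_deriv_path t k : V t -> jacobian_r G (y t) t \in unitmx ->
  (0 < k)%N -> num_deriv G (y t) t k = y^`(k)%classic t.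
Proof.
move=> Vt uJ k0; rewrite /num_deriv num_derivs_path//.
by rewrite (nth_map 0%N) ?size_iota ?nth_iota ?add0n ?prednK.
Qed.

End Path.
End Represented.

(** * The Blahut-Arimoto map as an expression *)

Section BAExpression.
Context {R : realType} {N M : nat}.
Variables (p : 'rV[R]_N) (d : 'M[R]_(N, M)).

Definition sum_expr (s : seq (@expr R M)) : expr := foldr (@Add R M) (Cst 0) s.

Definition partition_expr (x : 'I_N) : expr :=
  sum_expr [seq Mul (Var i) (Exp (d x i)) | i <- enum 'I_M].

Definition FBA_expr (j : 'I_M) : expr :=
  Add (Var j) (Mul (Cst (-1)) (sum_expr
    [seq Mul (Cst (p 0 x)) (Mul (Mul (Var j) (Exp (d x j))) (Inv (partition_expr x)))
    | x <- enum 'I_N])).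

Lemma eval_sum_expr s r b : eval (sum_expr s) r b = \sum_(e <- s) eval e r b.
Proof. by elim: s => [|e s IH] /=; rewrite ?big_nil// big_cons IH. Qed.

Lemma inverted_sum_expr P s :
  (forall e, List.In e s -> inverted P e) -> inverted P (sum_expr s).
Proof.
elim: s => //= e s IH H; split; first by apply: H; left.
by apply: IH => e' H'; apply: H; right.
Qed.

Lemma eval_partition_expr x r b :
  eval (partition_expr x) r b = partition_fun d b r x.
Proof.
rewrite eval_sum_expr big_map big_enum /=.
by apply: eq_bigr => i _ /=; rewrite mulrC.
Qed.

Lemma FBA_exprE : represents (FBA p d) FBA_expr.
Proof.
move=> r b j _; rewrite /= eval_sum_expr big_map big_enum /= !mxE mulN1r.
congr (_ - _); apply: eq_bigr => x _ /=.
by rewrite mxE eval_partition_expr.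
Qed.

Lemma inverted_FBA_expr P j :
  (forall x, P (fun r b => partition_fun d b r x)) -> inverted P (FBA_expr j).
Proof.
move=> HP; do 2!split => //; apply: inverted_sum_expr => e.
have HP' x : P (eval (partition_expr x)).
  have -> // : eval (partition_expr x) = (fun r b => partition_fun d b r x).
  by apply/funext => r; apply/funext => b; exact: eval_partition_expr.
elim: (enum _) => //= x s IH [<-|]; last exact: IH.
do 3!split => //; apply: inverted_sum_expr => {IH}e.
by elim: (enum _) => //= i l IH [<-|]; [|exact: IH].
Qed.

Lemma partition_fun_gt0 (j : 'I_M) r b x : full_support r -> 0 < partition_fun d b r x.
Proof.
move=> pr; rewrite /partition_fun (bigD1 j)//= ltr_wpDr//.
  by apply: sumr_ge0 => i _; rewrite mulr_ge0 ?expR_ge0// ltW// pr.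
by rewrite mulr_gt0 ?expR_gt0// pr.
Qed.

Lemma regular_FBA_expr j : regular (FBA_expr j).
Proof.
by apply: inverted_FBA_expr => x r b pr; rewrite gt_eqF// (partition_fun_gt0 j).
Qed.

End BAExpression.


(** * Lipschitz continuity of the numerical derivatives *)

Section Lipschitz.
Context {R : realType} {M : nat} (K : 'rV[R]_M -> R -> Prop).
Implicit Types (r : 'rV[R]_M) (b : R) (f g : 'rV[R]_M -> R -> R).

(** Boundedness is bundled in to make the class closed under products. *)
Definition lip f : Prop := exists2 L, 0 <= L & forall b r r', K r b -> K r' b ->
  `|f r b| <= L /\ `|f r b - f r' b| <= L * `|r - r'|.

Definition away0 f : Prop :=
  exists2 c, 0 < c & forall r b, K r b -> c <= `|f r b|.

Lemma eq_lip f g : (forall r b, K r b -> f r b = g r b) -> lip f -> lip g.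
Proof.
move=> fg [L L0 H]; exists L => // b r r' Kr Kr'.
by rewrite -!fg//; apply: H.
Qed.

Lemma lip_bounded (h : R -> R) B :
  (forall r b, K r b -> `|h b| <= B) -> lip (fun=> h).
Proof.
move=> H; exists (`|B|) => // b r r' Kr _; split.
  by rewrite (le_trans (H _ _ Kr))// ler_norm.
by rewrite subrr normr0 mulr_ge0.
Qed.

Lemma lip_cst c : lip (fun _ _ => c).
Proof. by apply: (@lip_bounded (fun=> c) `|c|). Qed.

Lemma normr_coord r (j : 'I_M) : `|r 0 j| <= `|r|.
Proof.
rewrite [leRHS]/Num.Def.normr/= mx_normrE.
exact: (le_bigmax _ (fun ij : 'I_1 * 'I_M => `|r ij.1 ij.2|) (0, j)).
Qed.

Lemma lip_coord B (j : 'I_M) :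
  (forall r b, K r b -> `|r| <= B) -> lip (fun r _ => r 0 j).
Proof.
move=> H; exists (`|B| + 1); first by rewrite addr_ge0.
move=> b r r' Kr _; split.
  rewrite (le_trans (normr_coord _ _))// (le_trans (H _ _ Kr))//.
  by rewrite (le_trans (ler_norm _))// lerDl.
have -> : r 0 j - r' 0 j = (r - r') 0 j by rewrite !mxE.
rewrite (le_trans (normr_coord _ _))// ler_peMl//.
by rewrite lerDr.
Qed.

Lemma lipD f g : lip f -> lip g -> lip (fun r b => f r b + g r b).
Proof.
move=> [L L0 H] [L' L'0 H']; exists (L + L'); first exact: addr_ge0.
move=> b r r' Kr Kr'.
have [h1 h2] := H b r r' Kr Kr'; have [h1' h2'] := H' b r r' Kr Kr'.
split; first by rewrite (le_trans (ler_normD _ _))// lerD.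
by rewrite opprD addrACA (le_trans (ler_normD _ _))// mulrDl lerD.
Qed.

Lemma lipM f g : lip f -> lip g -> lip (fun r b => f r b * g r b).
Proof.
move=> [L L0 H] [L' L'0 H']; exists (L * L' + L * L').
  by rewrite addr_ge0// mulr_ge0.
move=> b r r' Kr Kr'.
have [h1 h2] := H b r r' Kr Kr'; have [h1' h2'] := H' b r r' Kr Kr'.
have [h3 _] := H' b r' r Kr' Kr.
split.
  rewrite normrM (le_trans (ler_pM _ _ h1 h1'))//.
  by rewrite lerDl mulr_ge0.
have -> : f r b * g r b - f r' b * g r' b =
  f r b * (g r b - g r' b) + (f r b - f r' b) * g r' b by ring.
rewrite (le_trans (ler_normD _ _))// !normrM mulrDl lerD//.
  by rewrite -mulrA ler_pM.
by rewrite mulrAC ler_pM.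
Qed.

Lemma lip_sum (I : Type) (s : seq I) (P : pred I) (F : I -> 'rV[R]_M -> R -> R) :
  (forall i, lip (F i)) -> lip (fun r b => \sum_(i <- s | P i) F i r b).
Proof.
move=> H; elim: s => [|i s IH].
  by apply: eq_lip (lip_cst 0) => r b _; rewrite big_nil.
case Pi: (P i).
  apply: eq_lip (lipD (H i) IH) => r b _; by rewrite big_cons Pi.
by apply: eq_lip IH => r b _; rewrite big_cons Pi.
Qed.

Lemma lip_prod (I : Type) (s : seq I) (P : pred I) (F : I -> 'rV[R]_M -> R -> R) :
  (forall i, lip (F i)) -> lip (fun r b => \prod_(i <- s | P i) F i r b).
Proof.
move=> H; elim: s => [|i s IH].
  by apply: eq_lip (lip_cst 1) => r b _; rewrite big_nil.
case Pi: (P i).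
  apply: eq_lip (lipM (H i) IH) => r b _; by rewrite big_cons Pi.
by apply: eq_lip IH => r b _; rewrite big_cons Pi.
Qed.

Lemma lipV f : away0 f -> lip f -> lip (fun r b => (f r b)^-1).
Proof.
(* The first summand bounds the inverse itself, the second is its Lipschitz constant. *)
move=> [c c0 Hc] [L L0 H]; exists (c^-1 + L / c ^+ 2).
  by rewrite addr_ge0 ?invr_ge0 ?divr_ge0 ?exprn_ge0// ltW.
have inv_le r b : K r b -> `|(f r b)^-1| <= c^-1.
  move=> Kr; rewrite normfV lef_pV2 ?Hc// posrE.
  exact: lt_le_trans (Hc _ _ Kr).
move=> b r r' Kr Kr'; split.
  by rewrite (le_trans (inv_le _ _ Kr))// lerDl divr_ge0 ?exprn_ge0// ltW.
have [_ h2] := H b r r' Kr Kr'.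
have f0 r1 : K r1 b -> f r1 b != 0.
  by move=> /Hc h; rewrite -normr_gt0 (lt_le_trans c0).
have -> : (f r b)^-1 - (f r' b)^-1 =
    - (f r b - f r' b) * ((f r b)^-1 * (f r' b)^-1).
  by field; rewrite !f0.
rewrite normrM normrN mulrDl ler_wpDl//.
  by rewrite mulr_ge0// invr_ge0 ltW.
rewrite mulrAC expr2 invfM; apply: ler_pM => //.
by rewrite normrM; apply: ler_pM => //; apply: inv_le.
Qed.

Lemma lip_det m (A : 'rV[R]_M -> R -> 'M[R]_m) :
  (forall i j, lip (fun r b => A r b i j)) -> lip (fun r b => \det (A r b)).
Proof.
move=> H; rewrite /determinant; apply: lip_sum => s; apply: lipM; first exact: lip_cst.
by apply: lip_prod => i; apply: H.
Qed.

(** Cramer's rule: cofactors and determinant are polynomials in the entries. A determinant away from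
    0 also excludes the default branch of [invmx]. *)
Lemma lip_invmx m (A : 'rV[R]_M -> R -> 'M[R]_m) i j :
  (forall i j, lip (fun r b => A r b i j)) -> away0 (fun r b => \det (A r b)) ->
  lip (fun r b => invmx (A r b) i j).
Proof.
move=> H Hd.
have : lip (fun r b => (\det (A r b))^-1 * cofactor (A r b) j i).
  apply: lipM; first by apply: lipV => //; exact: lip_det.
  rewrite /cofactor; apply: lipM; first exact: lip_cst.
  by apply: lip_det => i' j'; apply: eq_lip (H _ _) => r b _; rewrite !mxE.
apply: eq_lip => r b Kr; have [c c0 /(_ _ _ Kr) Hc] := Hd.
rewrite /invmx unitmxE unitfE -normr_gt0 (lt_le_trans c0)//.
by rewrite !mxE.
Qed.

Lemma lip_eval B (e : @expr R M) :
  (forall r b, K r b -> `|r| <= B) -> (forall r b, K r b -> `|b| <= B) ->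
  inverted away0 e -> lip (eval e).
Proof.
move=> rB bB; elim: e => //= [c|i|a|e1 H1 e2 H2|e1 H1 e2 H2|e1 H1].
- by move=> _; apply: lip_cst.
- by move=> _; apply: lip_coord rB.
- move=> _; apply: (@lip_bounded (fun b => expR (- (b * a))) (expR (B * `|a|))).
  move=> r b Kr; rewrite ger0_norm ?expR_ge0// ler_expR.
  rewrite (le_trans (ler_norm _))// normrN normrM ler_wpM2r//.
  exact: bB Kr.
- by move=> [h1 h2]; apply: lipD; auto.
- by move=> [h1 h2]; apply: lipM; auto.
- by move=> [h1 h2]; apply: lipV; auto.
Qed.

Lemma lip_dirderiv B (e : @expr R M) (w : 'rV[R]_M -> R -> nat -> 'rV[R]_M) (s : seq nat) :
  (forall r b, K r b -> `|r| <= B) -> (forall r b, K r b -> `|b| <= B) ->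
  inverted away0 e -> (forall k i, lip (fun r b => w r b k 0 i)) ->
  lip (fun r b => dirderiv e [seq w r b k | k <- s] r b).
Proof.
move=> rB bB + lw; elim: s e => [|k s IH] e ae /=; first exact: (lip_eval rB bB ae).
apply: lip_sum => i; apply: lipM; first exact: lw.
by apply: IH; apply: inverted_pderiv.
Qed.

Section NumDerivs.
Variables (G : 'rV[R]_M -> R -> 'rV[R]_M) (E : 'I_M -> @expr R M) (B : R).
Hypotheses (GE : represents G E) (rE : forall j, regular (E j)).
Hypotheses (rB : forall r b, K r b -> `|r| <= B)
  (bB : forall r b, K r b -> `|b| <= B) (Kpos : forall r b, K r b -> full_support r).
Hypotheses (aE : forall j, inverted away0 (E j)).

Lemma lip_jacobian_r i j : lip (fun r b => jacobian_r G r b i j).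
Proof.
have : lip (eval (pderiv (Some i) (E j))) by apply: (lip_eval rB bB); apply: inverted_pderiv.
apply: eq_lip => r b Kr.
by rewrite (jacobian_r_eval _ GE)// ?mxE//; apply: Kpos Kr.
Qed.

Hypothesis aJ : away0 (fun r b => \det (jacobian_r G r b)).

Lemma partition_argsE k (c : {ffun 'I_k.+1 -> 'I_k.+1}) (b : nat) (vs : seq 'rV[R]_M) :
  partition_args c b vs = [seq vs`_(i.-1) | i <- part_args c b].
Proof.
rewrite /part_args map_flatten -map_comp; congr flatten.
by apply: eq_map => i /=; rewrite map_nseq.
Qed.

Lemma lip_deriv_rhs k (vs : 'rV[R]_M -> R -> seq 'rV[R]_M) j :
  (forall i l, lip (fun r b => (vs r b)`_i 0 l)) ->
  lip (fun r b => deriv_rhs G r b k (vs r b) 0 j).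
Proof.
move=> lvs; rewrite /deriv_rhs; case: eqP => _.
  have : lip (fun r b => -1 * eval (pderiv None (E j)) r b).
    apply: lipM; first exact: lip_cst.
    by apply: (lip_eval rB bB); apply: inverted_pderiv.
  apply: eq_lip => r b Kr.
  by rewrite mxE (represents_partial_beta GE)// ?mulN1r//; apply: Kpos Kr.
have : lip (fun r b => -1 * \sum_(c : {ffun 'I_k.+1 -> 'I_k.+1} |
    nontrivial_partition c) \sum_(i < (mult1 c).+1) partition_coef c i *
    dirderiv (iter i (pderiv None) (E j)) [seq (vs r b)`_(l.-1) | l <- part_args c i] r b).
  apply: lipM; first exact: lip_cst.
  apply: lip_sum => c; apply: lip_sum => i; apply: lipM; first exact: lip_cst.
  apply: (lip_dirderiv (w := fun r b l => (vs r b)`_(l.-1)) _ rB bB) => //.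
  by elim: (nat_of_ord i) => //= m; apply: inverted_pderiv.
apply: eq_lip => r b Kr; rewrite mulN1r mxE; congr (- _).
rewrite summxE; apply: eq_bigr => c _; rewrite summxE; apply: eq_bigr => i _.
by rewrite mxE partition_argsE (Dform_dirderiv _ _ _ _ GE)//; apply: Kpos Kr.
Qed.

Lemma size_num_derivs r b k : size (num_derivs G r b k) = k.
Proof. by elim: k => //= k IH; rewrite size_rcons IH. Qed.

Lemma lip_num_derivs k i j : lip (fun r b => (num_derivs G r b k)`_i 0 j).
Proof.
elim: k i j => [|k IH] i j /=.
  by apply: eq_lip (lip_cst 0) => r b _; rewrite nth_nil mxE.
have [ik|ki|->] := ltngtP i k.
- apply: eq_lip (IH i j) => r b _.
  by rewrite nth_rcons size_num_derivs ik.
- apply: eq_lip (lip_cst 0) => r b _.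
  by rewrite nth_rcons size_num_derivs ltnNge (ltnW ki) gtn_eqF// mxE.
have : lip (fun r b => \sum_l deriv_rhs G r b k.+1 (num_derivs G r b k) 0 l *
    invmx (jacobian_r G r b) l j).
  apply: lip_sum => l; apply: lipM; first exact: lip_deriv_rhs.
  by apply: lip_invmx => // *; apply: lip_jacobian_r.
apply: eq_lip => r b _.
by rewrite nth_rcons size_num_derivs ltnn eqxx mxE.
Qed.

Lemma lip_num_deriv k : exists2 L, 0 <= L & forall b r r', K r b -> K r' b ->
  `|num_deriv G r b k - num_deriv G r' b k| <= L * `|r - r'|.
Proof.
have /choice [L HL] : forall j, exists L, 0 <= L /\ forall b r r', K r b -> K r' b ->
    `|num_deriv G r b k 0 j - num_deriv G r' b k 0 j| <= L * `|r - r'|.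
  move=> j; have [L L0 H] := lip_num_derivs k k.-1 j.
  by exists L; split => // b r r' Kr Kr'; have [] := H b r r' Kr Kr'.
exists (\sum_j L j); first by apply: sumr_ge0 => j _; case: (HL j).
move=> b r r' Kr Kr'; rewrite [leLHS]/Num.Def.normr/= mx_normrE.
have S0 : 0 <= \sum_j L j by apply: sumr_ge0 => j _; case: (HL j).
apply: bigmax_le => [|[i j] _]; first by rewrite mulr_ge0.
rewrite /= !mxE (ord1 i) (le_trans ((HL j).2 _ _ _ Kr Kr'))// ler_wpM2r//.
by rewrite (bigD1 j)//= lerDl sumr_ge0// => l _; case: (HL l).
Qed.

End NumDerivs.
End Lipschitz.


(** * Nonsingularity of the marginal Jacobian *)

Section Regularity.
Context {R : realType} {N M : nat}.
Variables (p : 'rV[R]_N) (d : 'M[R]_(N, M)) (beta : R).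
Implicit Types (r : 'rV[R]_M) (q : 'M[R]_(N, M)).

Lemma encoder_cond_dist (j : 'I_M) r : full_support r -> encoder d beta r \in @cond_dist R N M.
Proof.
move=> pr; rewrite inE => x; rewrite inE; have Z0 := partition_fun_gt0 d j beta x pr.
split=> [i|]; first by rewrite !mxE divr_ge0 ?mulr_ge0 ?expR_ge0// ltW.
under eq_bigr => i _ do rewrite !mxE.
by rewrite -mulr_suml divff// gt_eqF.
Qed.

Lemma sum_marginal q : p \in @simplex R N -> q \in @cond_dist R N M ->
  \sum_j marginal p q 0 j = 1.
Proof.
rewrite !inE => -[_ p1] qc; under eq_bigr => j _ do rewrite mxE.
rewrite exchange_big /= -p1; apply: eq_bigr => x _.
have := qc x; rewrite inE => -[_ q1].
rewrite -mulr_sumr -[RHS]mulr1 -q1; congr (_ * _).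
by apply: eq_bigr => j _; rewrite mxE.
Qed.

Lemma sum_joint q : p \in @simplex R N -> q \in @cond_dist R N M ->
  \sum_x \sum_j p 0 x * q x j = 1.
Proof.
move=> ps qc; rewrite exchange_big /= -(sum_marginal ps qc).
by apply: eq_bigr => j _; rewrite mxE.
Qed.

(** The ratio of the encoder to its marginal is e^(-beta d) / Z, so the distortion cancels and only
    - ln Z is averaged. *)
Lemma lagrangian_encoder r : full_support r -> BA p d beta r = r ->
  lagrangian p d beta (encoder d beta r) =
  - \sum_x \sum_j p 0 x * encoder d beta r x j * ln (partition_fun d beta r x).
Proof.
move=> pr BAr; rewrite /lagrangian /mutual_info /expected_distortion.
rewrite mulr_sumr -big_split -sumrN; apply: eq_bigr => x _ /=.
rewrite mulr_sumr -big_split -sumrN; apply: eq_bigr => j _ /=.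
rewrite -/(BA p d beta r) BAr.
have Z0 := partition_fun_gt0 d j beta x pr.
have -> : encoder d beta r x j / r 0 j =
    expR (- (beta * d x j)) / partition_fun d beta r x.
  by rewrite mxE; field; rewrite !gt_eqF// ?pr.
rewrite ln_div ?posrE ?expR_gt0// expRK; ring.
Qed.

(* With [u := s e^(-beta d) / (q Z)], the summands of the difference of the two
   Lagrangians are [- p q ln u >= p q (1 - u)], and the lower bounds sum to 0
   because [BA r = r] and [r] has full support. *)
Lemma encoder_minimizes r q : p \in @simplex R N -> full_support r ->
  BA p d beta r = r -> q \in @cond_dist R N M ->
  lagrangian p d beta (encoder d beta r) <= lagrangian p d beta q.
Proof.
move=> ps pr BAr qc; rewrite lagrangian_encoder//.
pose Z := partition_fun d beta r.
pose s := marginal p q.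
have p0 x : 0 <= p 0 x by move: ps; rewrite inE => -[].
have q0 x j : 0 <= q x j.
  by move: qc; rewrite inE => /(_ x); rewrite inE => -[/(_ j)]; rewrite mxE.
have s_ge x j : p 0 x * q x j <= s 0 j.
  by rewrite /s mxE (bigD1 x)//= lerDl sumr_ge0// => y _; rewrite mulr_ge0.
have s0 j : 0 <= s 0 j by rewrite /s mxE sumr_ge0// => x _; rewrite mulr_ge0.
(* The rows of both encoders sum to 1 and [Z x] does not depend on [j]. *)
have -> : \sum_x \sum_j p 0 x * encoder d beta r x j * ln (Z x) =
          \sum_x \sum_j p 0 x * q x j * ln (Z x).
  apply: eq_bigr => x _; rewrite -!mulr_suml -!mulr_sumr; congr (_ * _ * _).
  have [j|noj] := pickP 'I_M; last by apply: eq_bigr => j; have := noj j.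
  have := encoder_cond_dist j pr; rewrite inE => /(_ x); rewrite inE => -[_].
  move: qc; rewrite inE => /(_ x); rewrite inE => -[_].
  under eq_bigr => i _ do rewrite mxE; move=> ->.
  by under eq_bigr => i _ do rewrite mxE; move=> ->.
rewrite -subr_ge0 opprK.
have -> : lagrangian p d beta q + \sum_x \sum_j p 0 x * q x j * ln (Z x) =
  \sum_x \sum_j p 0 x * q x j * (ln (q x j / s 0 j) + beta * d x j + ln (Z x)).
  rewrite /lagrangian /mutual_info /expected_distortion.
  rewrite mulr_sumr -!big_split; apply: eq_bigr => x _ /=.
  rewrite mulr_sumr -!big_split; apply: eq_bigr => j _ /=.
  by rewrite -/s; ring.
have : \sum_x \sum_j (p 0 x * q x j -
    s 0 j * (p 0 x * (expR (- (beta * d x j)) / Z x))) = 0.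
  under eq_bigr => x _ do rewrite sumrB.
  rewrite sumrB sum_joint// exchange_big /=.
  have -> : 1 = \sum_j s 0 j by rewrite sum_marginal.
  rewrite -sumrB big1// => j _; rewrite -mulr_sumr.
  suff -> : \sum_x p 0 x * (expR (- (beta * d x j)) / Z x) = 1 by rewrite mulr1 subrr.
  have rj : r 0 j != 0 by rewrite gt_eqF// pr.
  apply: (mulfI rj); rewrite mulr1 -[in RHS]BAr mxE mulr_sumr.
  by apply: eq_bigr => x _; rewrite mxE /Z; ring.
move=> S0; rewrite -[leLHS]S0; apply: ler_sum => x _; apply: ler_sum => j _.
have Z0 : 0 < Z x by apply: partition_fun_gt0 => //; exact: j.
have e0 : 0 < expR (- (beta * d x j)) by exact: expR_gt0.
(* For joint probability 0 the summand is 0 whatever [ln] returns, and its lower bound is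
   nonpositive. *)
have [pq0|pq0] := eqVneq (p 0 x * q x j) 0.
  by rewrite pq0 mul0r sub0r oppr_le0 !mulr_ge0// ?invr_ge0 ltW.
have pq : 0 < p 0 x * q x j by rewrite lt_neqAle eq_sym pq0 mulr_ge0.
have sj : 0 < s 0 j by apply: lt_le_trans (s_ge x j).
have qj : 0 < q x j.
  by rewrite lt_neqAle q0 andbT eq_sym; apply: contra_neq pq0 => ->; rewrite mulr0.
set u := s 0 j * expR (- (beta * d x j)) / (q x j * Z x).
have u0 : 0 < u by rewrite divr_gt0// mulr_gt0.
have -> : ln (q x j / s 0 j) + beta * d x j + ln (Z x) = - ln u.
  rewrite /u !(ln_div, lnM) ?posrE ?mulr_gt0// expRK; ring.
have -> : s 0 j * (p 0 x * (expR (- (beta * d x j)) / Z x)) = p 0 x * q x j * u.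
  by rewrite /u; field; rewrite !gt_eqF.
rewrite -{1}[p 0 x * q x j]mulr1 -mulrBr ler_pM2l//.
have /le_ln1Dx lnu : -1 < u - 1 by rewrite ltrBrDr addNr.
by rewrite addrC subrK in lnu; rewrite lerNr opprB.
Qed.

Lemma achieving_encoder (j : 'I_M) r : p \in @simplex R N -> full_support r ->
  BA p d beta r = r -> achieving p d beta (encoder d beta r).
Proof.
move=> ps pr BAr; split; first exact: encoder_cond_dist.
  by rewrite /BA_enc -/(BA p d beta r) BAr.
by move=> q' qc; exact: encoder_minimizes.
Qed.

Lemma full_support_not_vanishing r : full_support r -> BA p d beta r = r ->
  ~ cluster_vanishing p d beta (encoder d beta r).
Proof.
move=> pr BAr [eps [rho [j [_ _ _ rhoE [_ rho0]]]]].
by move: rho0; rewrite rhoE -/(BA p d beta r) BAr => /eqP; rewrite gt_eqF// pr.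
Qed.

Lemma differentiable_mx (V : normedModType R) m n (f : V -> 'M[R]_(m, n)) x :
  (forall i j, differentiable (fun u => f u i j) x) -> differentiable f x.
Proof.
move=> H.
have -> : f = \sum_i \sum_j (fun u => f u i j *: delta_mx i j).
  apply/funext => u; rewrite [LHS]matrix_sum_delta fct_sumE.
  by apply: eq_bigr => i _; rewrite fct_sumE.
apply: differentiable_sum => i; apply: differentiable_sum => j.
exact: differentiableZl.
Qed.

Lemma differentiable_sumf (V : normedModType R) n (f : 'I_n -> V -> R) x :
  (forall i, differentiable (f i) x) ->
  differentiable (fun u => \sum_i f i u) x.
Proof. by move=> H; rewrite -fct_sumE; apply: differentiable_sum. Qed.

(** Needed to read ['d] in [encoder_jacobian] as a directional derivative. *)
Lemma differentiable_BA_enc (j : 'I_M) q : full_support (marginal p q) ->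
  differentiable (fun q' => q' - BA_enc p d beta q') q.
Proof.
move=> pm; apply: differentiable_mx => x i.
have dm k : differentiable (fun q' : 'M[R]_(N, M) => marginal p q' 0 k) q.
  have -> : (fun q' : 'M[R]_(N, M) => marginal p q' 0 k) =
    (fun q' => \sum_x p 0 x * q' x k) by apply/funext => q'; rewrite mxE.
  apply: differentiable_sumf => y; apply: differentiableM => //.
  exact: differentiable_coord.
have -> : (fun q' => (q' - BA_enc p d beta q') x i) =
   (fun q' : 'M[R]_(N, M) => q' x i) \-
   ((fun q' => marginal p q' 0 i * expR (- (beta * d x i))) \*
    (fun q' => (partition_fun d beta (marginal p q') x)^-1)).
  by apply/funext => q'; rewrite !mxE /= mxE.
apply: differentiableB; first exact: differentiable_coord.
apply: differentiableM; first by apply: differentiableM.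
apply: differentiableV; last by rewrite gt_eqF// partition_fun_gt0.
by apply: differentiable_sumf => k; apply: differentiableM.
Qed.

Lemma marginalD (s : R) (w q : 'M[R]_(N, M)) :
  marginal p (s *: w + q) = s *: marginal p w + marginal p q.
Proof.
apply/rowP => j; rewrite !mxE mulr_sumr -big_split; apply: eq_bigr => x _ /=.
by rewrite !mxE; ring.
Qed.

Definition encoder_expr x i : @expr R M :=
  Mul (Mul (Var i) (Exp (d x i))) (Inv (partition_expr d x)).

Lemma eval_encoder_expr x i r : eval (encoder_expr x i) r beta = encoder d beta r x i.
Proof. by rewrite /= eval_partition_expr mxE. Qed.

Lemma regular_encoder_expr x i : regular (encoder_expr x i).
Proof.
do 2!split => //.
  by move=> r b pr; rewrite eval_partition_expr gt_eqF// partition_fun_gt0.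
by apply: inverted_sum_expr => e; elim: (enum _) => //= k l IH [<-|]; [|exact: IH].
Qed.

(* If [v] is in the kernel of the marginal Jacobian, then the derivative [w] of
   the encoder in direction [v] has marginal [v] and is in the kernel of the
   encoder Jacobian. *)
Lemma jacobian_r_unit (j : 'I_M) r : full_support r -> BA p d beta r = r ->
  encoder_jacobian p d beta (encoder d beta r) \in unitmx ->
  jacobian_r (FBA p d) r beta \in unitmx.
Proof.
move=> pr BAr uE; rewrite unitmxE unitfE; apply/negP => /det0P[v v0 vJ].
pose w : 'M[R]_(N, M) := \matrix_(x, i)
  \sum_k v 0 k * eval (pderiv (Some k) (encoder_expr x i)) r beta.
have dw x i : is_derive (0 : R) 1 (fun h => encoder d beta (h *: v + r) x i) (w x i).
  rewrite mxE; under eq_fun do rewrite -eval_encoder_expr.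
  by apply: is_derive_eval_r => //; exact: regular_encoder_expr.
have mw : marginal p w = v.
  apply/rowP => i; rewrite mxE.
  (* One function differentiated in two ways: through its expression, where [v] in the kernel gives
     0, and as r minus the marginal of its encoder. *)
  have H1 : is_derive (0 : R) 1 (fun h => FBA p d (h *: v + r) beta 0 i) 0.
    have := is_derive_eval_r beta v (regular_FBA_expr p d i) pr.
    have -> : \sum_k v 0 k * eval (pderiv (Some k) (FBA_expr p d i)) r beta = 0.
      transitivity ((v *m jacobian_r (FBA p d) r beta) 0 i); last by rewrite vJ mxE.
      rewrite (jacobian_r_eval beta (FBA_exprE p d))//; last exact: regular_FBA_expr.
      by rewrite mxE; apply: eq_bigr => k _; rewrite mxE.
    apply: near_eq_is_derive; apply: filterS (near_full_support_line v pr) => h ph.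
    by rewrite (FBA_exprE p d).
  have H2 : is_derive (0 : R) 1 (fun h => FBA p d (h *: v + r) beta 0 i)
      (v 0 i - \sum_x p 0 x * w x i).
    have -> : (fun h => FBA p d (h *: v + r) beta 0 i) =
      (fun h : R => (h *: v + r) 0 i) \-
      (fun h : R => \sum_x p 0 x * encoder d beta (h *: v + r) x i).
      by apply/funext => h; rewrite [LHS]mxE [X in _ + X = _]mxE [X in - X]mxE.
    apply: is_deriveB; first exact: is_derive_line.
    by apply: is_derive_bigsum => x _; apply: is_deriveZ.
  have [_ e1] := H1; have [_ e2] := H2.
  by move: e2; rewrite e1 => /esym/eqP; rewrite subr_eq0 => /eqP.
have w0 : w != 0.
  apply: contra_neq v0 => w0; rewrite -mw w0; apply/rowP => i.
  by rewrite !mxE big1// => x _; rewrite mxE mulr0.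
have mq : marginal p (encoder d beta r) = r by exact: BAr.
have : 'd (fun q' => q' - BA_enc p d beta q') (encoder d beta r) w = 0.
  rewrite -deriveE; last by apply: differentiable_BA_enc => //; rewrite mq.
  (* Moving the encoder along [w] moves its marginal along [v], hence [BA_enc] again with derivative
     [w]. *)
  have : is_derive (encoder d beta r) w (fun q' => q' - BA_enc p d beta q') (w - w).
    apply: is_deriveB; apply: is_derive_mx => x i; apply: is_derive_along.
    by under eq_fun do rewrite /BA_enc marginalD mw mq.
  by move=> [_ ->]; rewrite subrr.
move=> dfw; have : mxvec w *m encoder_jacobian p d beta (encoder d beta r) = 0.
  by rewrite /encoder_jacobian mul_vec_lin dfw linear0.
move=> /(congr1 (mulmx^~ (invmx (encoder_jacobian p d beta (encoder d beta r))))).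
rewrite mulmxK// mul0mx => /(congr1 vec_mx).
by rewrite mxvecK linear0 => /eqP; rewrite (negPf w0).
Qed.

End Regularity.


(** * Convergence of the Taylor method *)

Section Taylor.
Context {R : realType}.

(** Induction on [m] by the mean value theorem: as a function of the step, the remainder of order
    m+1 vanishes at 0, and its derivative is the remainder of order m for the derived sequence. The
    factor 1/m! is given up, as only the power of [h] matters. *)
Lemma taylor_remainder (f : nat -> R -> R) (a b B : R) m :
  (forall k t, a <= t <= b -> is_derive t 1 (f k) (f k.+1 t)) ->
  (forall t, a <= t <= b -> `|f m t| <= B) ->
  forall x h : R, h <= 0 -> x <= b -> a <= x + h ->
  `|f 0%N (x + h) - \sum_(k < m) h ^+ k / k`!%:R * f k x| <= B * `|h| ^+ m.
Proof.
elim: m f => [|m IH] f df fB x h h0 xb axh.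
  rewrite big_ord0 subr0 expr0 mulr1; apply: fB; rewrite axh /=.
  by rewrite (le_trans _ xb)// gerDl.
pose f1 k := f k.+1.
have IH1 := IH f1 (fun k => df k.+1) fB.
pose g (s : R) := f 0%N (x + s) - \sum_(k < m.+1) s ^+ k / k`!%:R * f k x.
pose dg (s : R) := f 1%N (x + s) - \sum_(k < m) s ^+ k / k`!%:R * f k.+1 x.
have g_dg (s : R) : h <= s <= 0 -> is_derive s 1 g (dg s).
  move=> /andP[hs s0].
  have xs : a <= x + s <= b.
    by rewrite (le_trans axh) ?lerD2l//= (le_trans _ xb)// gerDl.
  apply: is_deriveB.
    have -> : (fun s => f 0%N (x + s)) = f 0%N \o +%R x by [].
    apply: (is_derive_eq (is_derive1_comp (df 0%N _ xs) _)).
    by rewrite add0r mulr1.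
  have -> : \sum_(k < m) s ^+ k / k`!%:R * f k.+1 x =
    \sum_(k < m.+1) k%:R * s ^+ k.-1 / k`!%:R * f k x.
    rewrite [RHS]big_ord_recl !mul0r add0r; apply: eq_bigr => k _.
    rewrite /= /bump /= add1n factS natrM; congr (_ * _).
    by rewrite -mulf_div divff ?pnatr_eq0// mul1r.
  apply: is_derive_bigsum => k _.
  have -> : (fun s => s ^+ k / k`!%:R * f k x) =
            (fun s => (f k x / k`!%:R) * s ^+ k).
    by apply/funext => u; ring.
  have H : is_derive s 1 (fun u : R => u ^+ k) (k%:R * s ^+ k.-1).
    apply: DeriveDef; first exact: exprn_derivable.
    by rewrite exp_derive /GRing.scale /= mulr1.
  apply: (is_derive_eq (is_deriveZ (f k x / k`!%:R) H)).
  by rewrite /GRing.scale /=; ring.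
have [||c] := @MVT_segment R g dg h 0 h0.
- by move=> s; rewrite in_itv /= => /andP[/ltW ? /ltW ?]; apply: g_dg; apply/andP.
- apply: derivable_within_continuous => s; rewrite in_itv /= => hs.
  by case: (g_dg s hs).
rewrite in_itv /= => /andP[hc c0].
have g0 : g 0 = 0.
  rewrite /g addr0 big_ord_recl expr0 fact0 divr1 mul1r big1 ?addr0 ?subrr//.
  by move=> k _; rewrite /= /bump /= add1n expr0n /= !mul0r.
rewrite g0 !sub0r mulrN => /oppr_inj gh.
rewrite -/(g h) gh normrM exprSr mulrA ler_wpM2r//.
rewrite (le_trans (IH1 x c c0 xb _))//; first by rewrite (le_trans axh)// lerD2l.
have B0 : 0 <= B.
  by apply: le_trans (normr_ge0 _) (fB x _); rewrite xb (le_trans axh)// gerDl.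
by rewrite ler_wpM2l// lerXn2r ?nnegrE// !ler0_norm// lerN2.
Qed.

End Taylor.
Section TaylorRow.
Context {R : realType} {M : nat}.

Lemma normr_row_le (v : 'rV[R]_M) B :
  0 <= B -> (forall j, `|v 0 j| <= B) -> `|v| <= B.
Proof.
move=> B0 H; rewrite [leLHS]/Num.Def.normr/= mx_normrE.
by apply: bigmax_le => // -[i j] _; rewrite /= (ord1 i).
Qed.

Lemma derivable_bounded (u : R -> R) (a b : R) : a <= b ->
  (forall t, a <= t <= b -> derivable u t 1) ->
  exists2 B, 0 <= B & forall t, a <= t <= b -> `|u t| <= B.
Proof.
move=> ab du.
have [|c _ Hc] := @EVT_max R u a b ab.
  by apply: derivable_within_continuous => t; rewrite in_itv; apply: du.
have [|c' _ Hc'] := @EVT_min R u a b ab.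
  by apply: derivable_within_continuous => t; rewrite in_itv; apply: du.
exists (`|u c| + `|u c'|); first by rewrite addr_ge0.
move=> t tab; have {}tab : t \in `[a, b] by rewrite in_itv.
rewrite ler_norml; apply/andP; split.
  rewrite lerNl (le_trans _ (_ : - u c' <= _)) ?lerN2 ?Hc'//.
  by rewrite (le_trans (ler_norm _))// normrN lerDr.
by rewrite (le_trans (Hc _ tab))// (le_trans (ler_norm _))// lerDl.
Qed.

Lemma taylor_remainder_row (V : set R) (y : R -> 'rV[R]_M) (a b : R) m :
  a <= b -> smooth_on V y -> (forall t, a <= t <= b -> V t) ->
  exists2 C, 0 <= C & forall x h : R, h <= 0 -> x <= b -> a <= x + h ->
    `|y (x + h) - \sum_(k < m) (h ^+ k / k`!%:R) *: (y^`(k)%classic x)|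
      <= C * `|h| ^+ m.
Proof.
move=> ab sy abV.
have dy k t j : a <= t <= b ->
    is_derive t 1 (fun u => y^`(k)%classic u 0 j) (y^`(k.+1)%classic t 0 j).
  by move=> /abV; exact: is_derive_derive1n.
have /choice [B HB] : forall j, exists B, 0 <= B /\
    forall t, a <= t <= b -> `|y^`(m)%classic t 0 j| <= B.
  move=> j; have [|B B0 HB] := derivable_bounded (u := fun t => y^`(m)%classic t 0 j) ab.
    by move=> t tab; case: (dy m t j tab).
  by exists B.
have B0 j : 0 <= B j by case: (HB j).
exists (\sum_j B j); first exact: sumr_ge0.
move=> x h h0 xb axh; apply: normr_row_le => [|j].
  by rewrite mulr_ge0 ?exprn_ge0// sumr_ge0.
have := taylor_remainder (f := fun k t => y^`(k)%classic t 0 j)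
  (fun k t => dy k t j) (HB j).2 h0 xb axh.
have -> : y^`(0)%classic (x + h) 0 j -
    \sum_(k < m) h ^+ k / k`!%:R * y^`(k)%classic x 0 j =
  (y (x + h) - \sum_(k < m) (h ^+ k / k`!%:R) *: (y^`(k)%classic x)) 0 j.
  rewrite [RHS]mxE [X in _ = _ + X]mxE summxE; congr (_ - _).
  by apply: eq_bigr => k _; rewrite mxE.
move=> /le_trans; apply; rewrite ler_wpM2r ?exprn_ge0//.
by rewrite (bigD1 j)//= lerDl sumr_ge0.
Qed.

End TaylorRow.

(** * Discrete Gronwall argument *)

Section Convergence.
Context {R : realType} {N M : nat}.
Variables (p : 'rV[R]_N) (d : 'M[R]_(N, M)) (l : nat) (y : R -> 'rV[R]_M).
Variables (beta0 betaf rho L C : R) (K : 'rV[R]_M -> R -> Prop).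
Local Notation T := (taylor_incr p d l).
Hypotheses (l_gt0 : (0 < l)%N) (betaf_le : betaf <= beta0) (rho_gt0 : 0 < rho).
Hypotheses (L_ge0 : 0 <= L) (C_ge0 : 0 <= C).
Hypothesis near_path : forall b r, betaf <= b <= beta0 ->
  `|r - y b| <= rho -> K r b.
Hypothesis lip_T : forall b r r' t, K r b -> K r' b -> `|t| <= 1 ->
  `|T r b t - T r' b t| <= L * `|r - r'|.
Hypothesis local_error : forall b t, t <= 0 -> `|t| <= 1 -> b <= beta0 ->
  betaf <= b + t -> `|y b + t *: T (y b) b t - y (b + t)| <= C * `|t| ^+ l.+1.

Lemma step_error r b t : t <= 0 -> `|t| <= 1 -> b <= beta0 -> betaf <= b + t ->
  `|r - y b| <= rho ->
  `|r + t *: T r b t - y (b + t)| <=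
     (1 + L * `|t|) * `|r - y b| + C * `|t| ^+ l.+1.
Proof.
move=> t0 t1 bb0 bft rb.
have bb : betaf <= b <= beta0 by rewrite bb0 andbT (le_trans bft)// gerDl.
have -> : r + t *: T r b t - y (b + t) =
    (r - y b) + t *: (T r b t - T (y b) b t) +
    (y b + t *: T (y b) b t - y (b + t)).
  by rewrite scalerBr [_ - _ + (_ - _)]addrACA -opprD addrA subrK.
rewrite (le_trans (ler_normD _ _))// lerD//; last exact: local_error.
rewrite (le_trans (ler_normD _ _))// mulrDl mul1r lerD2l normrZ.
rewrite mulrAC mulrC ler_wpM2r// lip_T//; apply: near_path => //.
by rewrite subrr normr0 ltW.
Qed.

(** Allows for n local errors C |h|^(l+1), each amplified by at most (1 + L |h|)^n <= e^(L n |h|),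
    where n |h| is at most the length of the interval. *)
Let C1 := (beta0 - betaf) * C * expR (L * (beta0 - betaf)).

Lemma C1_ge0 : 0 <= C1.
Proof. by rewrite !mulr_ge0 ?expR_ge0// subr_ge0. Qed.

Lemma gronwall_bound (h : R) n : n%:R * `|h| <= beta0 - betaf ->
  n%:R * (C * `|h| ^+ l.+1) * (1 + L * `|h|) ^+ n <= C1 * `|h| ^+ l.
Proof.
move=> nh.
have -> : n%:R * (C * `|h| ^+ l.+1) * (1 + L * `|h|) ^+ n =
  (n%:R * `|h|) * C * (1 + L * `|h|) ^+ n * `|h| ^+ l by rewrite exprS; ring.
have Lh : 0 <= 1 + L * `|h| by rewrite addr_ge0// mulr_ge0.
rewrite ler_wpM2r ?exprn_ge0// ler_pM//.
- by rewrite !mulr_ge0.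
- by rewrite exprn_ge0.
- by rewrite ler_wpM2r.
rewrite (@le_trans _ _ (expR (L * `|h|) ^+ n))//.
  by rewrite lerXn2r ?nnegrE ?expR_ge0// expR_ge1Dx.
by rewrite -expRM_natl ler_expR mulrCA ler_wpM2l.
Qed.

Lemma grid_error (h : R) n : h < 0 -> `|h| <= 1 -> C1 * `|h| ^+ l <= rho ->
  betaf <= grid beta0 h n ->
  `|taylor_grid p d l (y beta0) beta0 h n - y (grid beta0 h n)| <= C1 * `|h| ^+ l.
Proof.
move=> h0 h1 hrho.
have nhE m : betaf <= grid beta0 h m -> m%:R * `|h| <= beta0 - betaf.
  by rewrite /grid ltr0_norm// => ?; lra.
(* Looser than the geometric sum of the amplified local errors, but free of a division by [L], which
   may be 0. *)
suff H m : betaf <= grid beta0 h m ->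
    `|taylor_grid p d l (y beta0) beta0 h m - y (grid beta0 h m)| <=
    m%:R * (C * `|h| ^+ l.+1) * (1 + L * `|h|) ^+ m.
  by move=> gn; rewrite (le_trans (H _ gn))// gronwall_bound// nhE.
elim: m => [|m IH] gm.
  by rewrite /grid /= mul0r addr0 subrr normr0 !mul0r.
have gS : grid beta0 h m.+1 = grid beta0 h m + h.
  by rewrite /grid -natr1 mulrDl mul1r addrA.
rewrite gS in gm *.
have gm' : betaf <= grid beta0 h m by rewrite (le_trans gm)// gerDl ltW.
have {}IH := IH gm'.
(* The iterate is still in the tube around the path, so the Lipschitz bound applies to the next
   step. *)
have err : `|taylor_grid p d l (y beta0) beta0 h m - y (grid beta0 h m)| <= rho.
  by rewrite (le_trans IH)// (le_trans (gronwall_bound (nhE _ gm'))).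
rewrite /= (le_trans (step_error (ltW h0) h1 _ gm err))//.
  by rewrite /grid gerDl mulr_ge0_le0// ltW.
have Lh : 1 <= 1 + L * `|h| by rewrite lerDl mulr_ge0.
have Lh0 : 0 <= 1 + L * `|h| by rewrite (le_trans _ Lh).
have Ch : 0 <= C * `|h| ^+ l.+1 by rewrite mulr_ge0 ?exprn_ge0.
set X := C * _ in IH Ch *; set Q := 1 + _ in IH Lh Lh0 *.
have -> : m.+1%:R * X * Q ^+ m.+1 = Q * (m%:R * X * Q ^+ m) + X * Q ^+ m.+1.
  by rewrite -natr1 exprS; ring.
by rewrite lerD// ?ler_wpM2l// ler_peMr// exprn_ege1.
Qed.

Lemma taylor_convergence :
  exists C', \forall h \near 0^'-, forall beta, betaf <= beta <= beta0 ->
    (forall n, beta < grid beta0 h n ->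
       K (taylor_grid p d l (y beta0) beta0 h n) (grid beta0 h n)) /\
    `|taylor_approx p d l (y beta0) beta0 h beta - y beta| <= C' * `|h| ^+ l.
Proof.
exists ((1 + L) * C1 + C); near=> h.
have h0 : h < 0 by near: h; exact: nbhs_left_lt.
have hN1 : -1 < h by near: h; apply: nbhs_left_gt; rewrite ltrN10.
(* Keeps [C1] times the power of |h| below [rho]; the added 1 avoids dividing by 0. *)
have hrho : - (rho / (C1 + 1)) < h.
  near: h; apply: nbhs_left_gt.
  by rewrite oppr_lt0 divr_gt0// ltr_wpDl// C1_ge0.
have h1 : `|h| <= 1 by rewrite ltr0_norm// lerNl ltW.
have hl : `|h| ^+ l <= `|h|.
  by case: l l_gt0 => // l' _; rewrite exprS ler_piMr// exprn_ile1.
have C1h : C1 * `|h| ^+ l <= rho.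
  apply: (@le_trans _ _ ((C1 + 1) * `|h|)).
    by rewrite ler_pM ?C1_ge0 ?exprn_ge0// lerDl.
  rewrite mulrC -ler_pdivlMr; last by rewrite ltr_wpDl// C1_ge0.
  by rewrite ltr0_norm// lerNl ltW.
move=> beta /andP[bfb bb0].
have grid_le n : grid beta0 h n <= beta0.
  by rewrite /grid gerDl mulr_ge0_le0// ltW.
split=> [n bn|].
  have gn : betaf <= grid beta0 h n by rewrite (le_trans bfb)// ltW.
  apply: near_path; first by rewrite gn grid_le.
  by rewrite (le_trans (grid_error _ _ _ _)).
rewrite /taylor_approx; set n := Num.truncn _.
have q0 : 0 <= (beta - beta0) / h.
  by rewrite mulr_le0// ?subr_le0// invr_le0 ltW.
have /andP[qn nq] := truncn_itv q0; rewrite -/n in qn nq.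
have gb : beta <= grid beta0 h n.
  by move: qn; rewrite ler_ndivlMr// /grid lerBlDl.
have bg : grid beta0 h n + h < beta.
  move: nq; rewrite ltr_ndivrMr// /grid -natr1 mulrDl mul1r ltrBrDl addrA.
  by [].
have gn : betaf <= grid beta0 h n by rewrite (le_trans bfb).
set t := beta - grid beta0 h n.
have t0 : t <= 0 by rewrite subr_le0.
have th : `|t| <= `|h| by rewrite ler0_norm// ltr0_norm// lerN2 lerBrDl ltW.
have t1 : `|t| <= 1 by rewrite (le_trans th).
have tE : grid beta0 h n + t = beta by rewrite /t addrC subrK.
have e := grid_error h0 h1 C1h gn.
have := step_error t0 t1 (grid_le n) _ (le_trans e C1h).
rewrite tE => /(_ bfb) /le_trans; apply.
rewrite [leRHS]mulrDl lerD//.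
  rewrite -mulrA ler_pM ?addr_ge0 ?mulr_ge0//.
  by rewrite lerD2l ler_piMr.
rewrite ler_wpM2l// (le_trans (_ : _ <= `|h| ^+ l.+1))//.
  by rewrite lerXn2r ?nnegrE.
by rewrite exprS ler_piMl// exprn_ge0.
Unshelve. all: by end_near. Qed.

End Convergence.


(** * The box around the initial point *)

Section Continuity.
Context {R : realType}.

Lemma continuous_at_bigsum (I : Type) (s : seq I) (P : pred I) (F : I -> R -> R) b :
  (forall i, continuous_at b (F i)) ->
  continuous_at b (fun u => \sum_(i <- s | P i) F i u).
Proof.
move=> H; rewrite -fct_sumE.
apply: (big_ind (fun g : R -> R => continuous_at b g)) => //.
  by move=> t; exact: (@cst_continuous _ _ (0 : R) b t).
by move=> f g cf cg; exact: (continuousD cf cg).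
Qed.

Lemma continuous_at_bigprod (I : Type) (s : seq I) (P : pred I) (F : I -> R -> R) b :
  (forall i, continuous_at b (F i)) ->
  continuous_at b (fun u => \prod_(i <- s | P i) F i u).
Proof.
move=> H; elim: s => [|i s IH].
  under eq_fun do rewrite big_nil; by move=> t; exact: (@cst_continuous _ _ (1 : R) b t).
under eq_fun do rewrite big_cons; case: (P i) => //.
exact: (continuousM (H i) IH).
Qed.

Lemma continuous_at_det m (A : R -> 'M[R]_m) b :
  (forall i j, continuous_at b (fun u => A u i j)) ->
  continuous_at b (fun u => \det (A u)).
Proof.
move=> H; rewrite /determinant; apply: continuous_at_bigsum => s.
have c1 (c : R) : continuous_at b (cst c) by move=> t; exact: cst_continuous.
apply: (continuousM (c1 _)); exact: continuous_at_bigprod.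
Qed.

Lemma is_derive_continuous (f : R -> R) (b df : R) : is_derive b 1 f df ->
  continuous_at b f.
Proof. by move=> [/derivable1_diffP /differentiable_continuous]. Qed.

End Continuity.

Section Box.
Context {R : realType} {N M : nat}.
Variables (p : 'rV[R]_N) (d : 'M[R]_(N, M)) (r0 : 'rV[R]_M) (beta0 delta : R).
Hypotheses (delta_gt0 : 0 < delta) (r0_gt : forall j, delta < r0 0 j).

Definition box (rho eta : R) (r : 'rV[R]_M) (b : R) : Prop :=
  `|r - r0| <= rho /\ `|b - beta0| <= eta.

Lemma box_ge rho eta r b j : rho <= delta / 2 -> box rho eta r b ->
  delta / 2 <= r 0 j.
Proof.
move=> rd [rr _]; have := normr_coord (r - r0) j; rewrite !mxE => h.
have := le_trans h (le_trans rr rd); rewrite ler_norml => /andP[h1 _].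
by have := r0_gt j; lra.
Qed.

Lemma box_full_support rho eta r b : rho <= delta / 2 -> box rho eta r b -> full_support r.
Proof.
by move=> rd Kr j; apply: lt_le_trans (box_ge j rd Kr); rewrite divr_gt0.
Qed.

(** One bound for both |r| and |b|, as [lip_eval] takes a single constant. *)
Let B := `|r0| + delta / 2 + (`|beta0| + 1).

Lemma box_boundr rho eta r b : rho <= delta / 2 -> box rho eta r b -> `|r| <= B.
Proof.
move=> rd [rr _]; have := ler_normD (r - r0) r0; rewrite subrK /B.
by have := normr_ge0 beta0; lra.
Qed.

Lemma box_boundb rho eta r b : eta <= 1 -> box rho eta r b -> `|b| <= B.
Proof.
move=> e1 [_ bb]; have := ler_normD (b - beta0) beta0; rewrite subrK /B.
by have := normr_ge0 r0; have := delta_gt0; lra.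
Qed.

(** The summand of the single symbol [j] already bounds the partition function from below. [b] may
    be negative in the box, hence the absolute values in the exponent. *)
Lemma away0_FBA_expr rho eta j : rho <= delta / 2 -> eta <= 1 ->
  inverted (away0 (box rho eta)) (FBA_expr p d j).
Proof.
move=> rd e1; apply: inverted_FBA_expr => x.
exists (delta / 2 * expR (- (B * `|d x j|))).
  by rewrite mulr_gt0 ?expR_gt0// divr_gt0.
move=> r b Kr; rewrite [leRHS]ger0_norm; last first.
  exact: ltW (partition_fun_gt0 d j b x (box_full_support rd Kr)).
rewrite /partition_fun (bigD1 j)//= ler_wpDr//.
  apply: sumr_ge0 => i _; rewrite mulr_ge0 ?expR_ge0// ltW//.
  exact: (box_full_support rd Kr).
apply: ler_pM; rewrite ?expR_ge0 ?divr_ge0 ?(ltW delta_gt0)//.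
  exact: (box_ge _ rd Kr).
rewrite ler_expR lerN2 (le_trans (ler_norm _))// normrM ler_wpM2r//.
exact: (box_boundb e1 Kr).
Qed.

Lemma half_norm_le (x y z : R) :
  `|x - y| <= `|x| / 4 -> `|z - y| <= `|x| / 4 -> `|x| / 2 <= `|z|.
Proof.
move=> xy zy; have := ler_normD (x - y) (y - z); have := ler_normD (x - z) z.
by rewrite addrA !subrK (distrC y z); lra.
Qed.

(* The box does not depend on the order of the Taylor method. *)
Lemma nonsingular_box : (0 < M)%N ->
  jacobian_r (FBA p d) r0 beta0 \in unitmx ->
  exists rho eta, [/\ 0 < rho <= delta / 2, 0 < eta <= 1 &
    away0 (box rho eta) (fun r b => \det (jacobian_r (FBA p d) r b))].
Proof.
move=> M0; rewrite unitmxE unitfE => J0.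
pose detJ r b := \det (jacobian_r (FBA p d) r b).
(* The determinant is compared in two moves: from [r] to [r0] at fixed [b] by this Lipschitz bound,
   then from [b] to [beta0] at [r0] by continuity. Each costs at most a quarter of its value at the
   centre. *)
have [] : lip (box (delta / 2) 1) detJ.
  apply: lip_det => i j.
  apply: (lip_jacobian_r (E := FBA_expr p d) (B := B)).
  - exact: FBA_exprE.
  - exact: regular_FBA_expr.
  - by move=> r b; apply: box_boundr.
  - by move=> r b; apply: box_boundb.
  - by move=> r b; apply: box_full_support.
  - by move=> k; apply: away0_FBA_expr.
move=> L L0 HL.
pose c := `|detJ r0 beta0|.
have c0 : 0 < c by rewrite normr_gt0.
have pr0 : full_support r0 by move=> j; apply: lt_trans (r0_gt j).
have : continuous_at beta0 (detJ r0).
  apply: continuous_at_det => i j.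
  under eq_fun do rewrite (jacobian_r_eval _ (FBA_exprE p d) (regular_FBA_expr p d) pr0) mxE.
  apply: is_derive_continuous; apply: is_derive_eval_b => //.
  exact/regular_pderiv/regular_FBA_expr.
move=> /cvgr_dist_le /(_ (c / 4)) H.
have /nbhs_ballP[e /= e0 He] := H (divr_gt0 c0 (ltr0n R 4)).
have e2 : 0 < Num.min 1 (e / 2) by rewrite lt_min ltr01 divr_gt0.
have L1 : 0 < L + 1 by rewrite ltr_wpDl.
exists (Num.min (delta / 2) (c / 4 / (L + 1))), (Num.min 1 (e / 2)).
split; first by rewrite ge_min lexx lt_min !divr_gt0.
  by rewrite e2 ge_min lexx.
exists (c / 2); first by rewrite divr_gt0.
move=> r b [rr bb]; move: rr bb; rewrite !le_min => /andP[rd rL] /andP[b1 be].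
have h1 : `|detJ r0 beta0 - detJ r0 b| <= c / 4.
  apply: He; rewrite /ball /= distrC (le_lt_trans be)//.
  by rewrite ltr_pdivrMr// ltr_pMr// ltr1n.
have K0 : box (delta / 2) 1 r0 b by split=> //; rewrite subrr normr0 divr_ge0// ltW.
have [_ h2] := HL b r r0 (conj rd b1) K0.
have h3 : L * `|r - r0| <= c / 4.
  rewrite (le_trans (_ : _ <= (L + 1) * `|r - r0|))//.
    by rewrite ler_wpM2r// lerDl.
  by rewrite mulrC -ler_pdivlMr.
exact: half_norm_le h1 (le_trans h2 h3).
Qed.

End Box.

(** * The Taylor increment *)

Section TaylorIncrement.
Context {R : realType} {N M : nat}.
Variables (p : 'rV[R]_N) (d : 'M[R]_(N, M)) (l : nat).

Lemma taylor_incrE r b t : taylor_incr p d l r b t =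
  \sum_(k < l) (t ^+ k / k.+1`!%:R) *: num_deriv (FBA p d) r b k.+1.
Proof. by rewrite /taylor_incr big_add1 /= big_mkord. Qed.

Lemma lip_taylor_incr (K : 'rV[R]_M -> R -> Prop) :
  (forall k, exists2 L, 0 <= L & forall b r r', K r b -> K r' b ->
    `|num_deriv (FBA p d) r b k - num_deriv (FBA p d) r' b k| <= L * `|r - r'|) ->
  exists2 L, 0 <= L & forall b r r' t, K r b -> K r' b -> `|t| <= 1 ->
    `|taylor_incr p d l r b t - taylor_incr p d l r' b t| <= L * `|r - r'|.
Proof.
move=> H.
have /choice [L HL] : forall k, exists L, 0 <= L /\ forall b r r', K r b -> K r' b ->
    `|num_deriv (FBA p d) r b k - num_deriv (FBA p d) r' b k| <= L * `|r - r'|.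
  by move=> k; have [L ? ?] := H k; exists L.
exists (\sum_(k < l) L k.+1); first by apply: sumr_ge0 => k _; case: (HL k.+1).
move=> b r r' t Kr Kr' t1; rewrite !taylor_incrE -sumrB mulr_suml.
rewrite (le_trans (ler_norm_sum _ _ _))//; apply: ler_sum => k _.
have [L0 HLk] := HL k.+1.
rewrite -scalerBr normrZ -[leRHS]mul1r ler_pM//; last exact: HLk.
rewrite normrM normrX mulr_ile1 ?exprn_ile1// normfV invf_le1 ?normr_gt0.
  by rewrite normr_nat ler1n fact_gt0.
by rewrite pnatr_eq0 -lt0n fact_gt0.
Qed.

(** From an exact point, a step is the Taylor polynomial of degree [l] of the path, so its local
    error is the Taylor remainder. *)
Lemma taylor_step_path (y : R -> 'rV[R]_M) b t :
  (forall k, (0 < k)%N -> num_deriv (FBA p d) (y b) b k = y^`(k)%classic b) ->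
  y b + t *: taylor_incr p d l (y b) b t =
  \sum_(k < l.+1) (t ^+ k / k`!%:R) *: (y^`(k)%classic b).
Proof.
move=> H; rewrite big_ord_recl expr0 fact0 divr1 scale1r; congr (_ + _).
rewrite taylor_incrE scaler_sumr; apply: eq_bigr => k _.
by rewrite H// scalerA mulrA -exprS.
Qed.

End TaylorIncrement.


Theorem theorem5 (R : realType) (N M : nat) (p : 'rV[R]_N) (d : 'M[R]_(N, M))
    (I : set R) (beta0 : R) (r : R -> 'rV[R]_M) (delta : R) :
  p \in @simplex R N ->
  nonneg_distortion d ->
  non_degenerate d ->
  regularity_assumption p d ->
  open I -> is_interval I -> I beta0 -> 0 < beta0 ->
  smooth_on I r ->
  (forall beta, I beta -> r beta \in @simplex R M) ->
  (forall beta, I beta -> BA p d beta (r beta) = r beta) ->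
  (forall xh, 0 < r beta0 0 xh) ->
  0 < delta -> (forall xh, delta < r beta0 0 xh) ->
  exists beta_f : R,
    [/\ 0 <= beta_f < beta0,
        `[beta_f, beta0] `<=` I,
        forall beta, beta \in `[beta_f, beta0] ->
          forall xh, delta <= r beta 0 xh &
        forall l : nat, (0 < l)%N ->
          exists C : R, \forall h \near 0^'-,
            forall beta, beta \in `[beta_f, beta0] ->
              taylor_defined p d l (r beta0) beta0 h beta /\
              `|taylor_approx p d l (r beta0) beta0 h beta - r beta|
                <= C * `|h| ^+ l].
Proof.
move=> ps _ _ reg openI _ Ib0 b0_gt0 smooth_r r_simplex root_r r0_gt0 d0 dr.
have M0 : (0 < M)%N.
  rewrite lt0n; apply/eqP => M0; have := r_simplex _ Ib0; rewrite inE => -[_].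
  rewrite big1 => [/eqP|j _]; first by rewrite eq_sym oner_eq0.
  by have := ltn_ord j; rewrite [X in (_ < X)%N -> _]M0.
pose j0 : 'I_M := Ordinal M0.
have BAr0 := root_r _ Ib0.
have J0 : jacobian_r (FBA p d) (r beta0) beta0 \in unitmx.
  apply: (jacobian_r_unit j0) => //; apply: reg => //.
    exact: achieving_encoder.
  exact: full_support_not_vanishing.
have [rho [eta [/andP[rho0 rhod] /andP[eta0 eta1] aJ]]] := nonsingular_box d0 dr M0 J0.
pose K := box (r beta0) beta0 rho eta.
have Kpos r1 b : K r1 b -> full_support r1 by exact: (box_full_support d0 dr rhod).
have cvg_r j : r b 0 j @[b --> beta0] --> r beta0 0 j.
  apply: (@is_derive_continuous _ (fun b => r b 0 j)).
  exact: (is_derive_derive1n smooth_r 0 j Ib0).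
(* The path stays within [rho / 2] of its start, so the tube of radius [rho / 2] around it lies in
   the box. *)
have : \forall b \near beta0, [/\ I b, 0 < b, `|b - beta0| <= eta,
    forall j, delta < r b 0 j & forall j, `|r b 0 j - r beta0 0 j| <= rho / 2].
  near=> b; split.
  - by near: b; exact: open_nbhs_nbhs.
  - by near: b; exact: cvgr_gt (@cvg_id _ (nbhs beta0)) _ b0_gt0.
  - by near: b; apply: cvgr_distC_le => //; exact: cvg_id.
  - by near: b; apply: filter_forall => j; exact: cvgr_gt (cvg_r j) _ (dr j).
  - near: b; apply: filter_forall => j.
    by apply: (cvgr_distC_le _ _ (cvg_r j)); rewrite divr_gt0.
move=> /nbhs_ballP[e /= e0 He].
(* Half the radius puts the closed interval inside the open ball, on which the path is
   differentiated. *)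
pose betaf := beta0 - e / 2.
have V b : betaf <= b <= beta0 -> ball beta0 e b.
  move=> /andP[b1 b2]; rewrite /ball /= ger0_norm ?subr_ge0//.
  by move: b1; rewrite /betaf; lra.
have bf : betaf < beta0 by rewrite /betaf; lra.
have near_path b r1 : betaf <= b <= beta0 -> `|r1 - r b| <= rho / 2 -> K r1 b.
  move=> /V /He[_ _ be _ rr] r1b; split=> //.
  rewrite -(subrKA (r b)) (le_trans (ler_normD _ _))// [rho]splitr lerD//.
  apply: normr_row_le => [|j]; first by rewrite divr_ge0// ltW.
  by rewrite !mxE; exact: rr.
have path_K b : betaf <= b <= beta0 -> K (r b) b.
  by move=> bb; apply: near_path => //; rewrite subrr normr0 divr_ge0// ltW.
have J b r1 : K r1 b -> jacobian_r (FBA p d) r1 b \in unitmx.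
  move=> Kr; have [c c0 Hc] := aJ; rewrite unitmxE unitfE -normr_gt0.
  exact: lt_le_trans (Hc _ _ Kr).
have smooth_V : smooth_on (ball beta0 e) r.
  by move=> n b /He[Ib _ _ _ _]; exact: smooth_r.
have pos_V b : ball beta0 e b -> full_support (r b).
  by move=> /He[_ _ _ rd _] j; exact: lt_trans (rd j).
have root_V b : ball beta0 e b -> FBA p d (r b) b = 0.
  by move=> /He[Ib _ _ _ _]; rewrite /FBA root_r// subrr.
exists betaf; split.
- have : ball beta0 e betaf by apply: V; rewrite lexx ltW.
  by move=> /He[_ /ltW -> _ _ _].
- by move=> b /=; rewrite in_itv /= => /V /He[].
- by move=> b; rewrite in_itv /= => /V /He[_ _ _ rd _] xh; exact/ltW/rd.
move=> l l0.
have lipK k : exists2 L, 0 <= L & forall b r1 r2, K r1 b -> K r2 b ->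
    `|num_deriv (FBA p d) r1 b k - num_deriv (FBA p d) r2 b k| <= L * `|r1 - r2|.
  apply: (lip_num_deriv (K := K) (FBA_exprE p d) (regular_FBA_expr p d)
    (fun r1 b => box_boundr (eta := eta) rhod)
    (fun r1 b => box_boundb d0 (rho := rho) eta1)) => //.
  by move=> j; exact: (@away0_FBA_expr R N M p d _ _ _ d0 dr rho eta j rhod eta1).
have [L L0 HL] := lip_taylor_incr l lipK.
have [C C0 HC] := taylor_remainder_row l.+1 (ltW bf) smooth_V V.
have [|C' HC'] := @taylor_convergence R N M p d l r beta0 betaf (rho / 2) L C K
    l0 (ltW bf) (divr_gt0 rho0 (ltr0n R 2)) L0 C0 near_path HL.
  move=> b t t0 _ bb0 bft.
  have bb : betaf <= b <= beta0 by rewrite bb0 andbT (le_trans bft)// gerDl.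
  rewrite taylor_step_path => [|k k0]; first by rewrite distrC HC.
  have openV : open (ball beta0 e : set R) by exact: ball_open.
  have uJ := J _ _ (path_K b bb); have Vb := V b bb.
  have path_deriv := num_deriv_path (FBA_exprE p d) (regular_FBA_expr p d)
    openV smooth_V pos_V root_V Vb uJ.
  exact: path_deriv k0.
exists C'; apply: filterS HC' => h Hh b; rewrite in_itv /= => /Hh[Hgrid err].
split; last exact: err.
move=> n /Hgrid Kn; split; last exact: (J _ _ Kn).
by move=> x; rewrite gt_eqF// (partition_fun_gt0 d j0)//; exact: Kpos Kn.
Unshelve. all: by end_near. Qed.
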